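(* Let $(X,d_X,\odot,0_X)$ be an editable space and let $T$, $T'$ be $X$-valued dendrograms without degree $2$ vertices. Then $$d_E(T,T')= \min_{M^*\in \mathcal{C}^*(T,T')}\left( \sum_{(x,y)\in M^*}d_E(sub_T(x),sub_{T'}(y))+cost(\alpha(M^* ))\right).$$
   Context: **Editable spaces.** An editable space is a set $X$ with a metric $d_X$, an operation $\odot$ and an element $0_X$ such that: (P1) $(X,d_X)$ is a metric space; (P2) $(X,\odot,0_X)$ is a commutative monoid; (P3) $d_X(0_X,x\odot y)=d_X(0_X,x)+d_X(0_X,y)$ for all $x,y$; (P4) $d_X(x,y)=d_X(z\odot x,z\odot y)=d_X(x\odot z,y\odot z)$ for all $x,y,z$. **Dendrograms.** A tree structure $T$ is a finite connected rooted acyclic graph $(V_T,E_T)$ with root $r_T$. The relation child $<$ parent generates a partial order on $V_T$. Each edge is written $(a,b)$ with $a<b$ ($b$ the parent of $a$) and is identified with its lower vertex $a$, so $E_T\cong V_T\setminus\{r_T\}$. A ''degree $2$ vertex'' is a non-root vertex with exactly one child. An ($X$-valued) dendrogram is a tree structure $T$ with a weight function $\varphi_T:E_T\to X\setminus\{0_X\}$. Dendrograms are considered up to isomorphism of rooted trees preserving weights. For $v\in V_T$, $sub_T(v)$ is the dendrogram with vertex set $\{x\in V_T\mid x\le v\}$, root $v$, and restricted weights. **Edits and costs.** - Shrinking an edge: replace its weight $x$ by another element $y\in X\setminus\{0_X\}$; cost $d_X(x,y)$. - Deleting an edge $(v_1,v_2)$ of weight $x$: remove $v_1$, its children becoming children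 of $v_2$ (keeping their weights); cost $d_X(x,0_X)$. Its inverse is the insertion of an edge of weight $x\in X\setminus\{0_X\}$ at a vertex $v$ (a new child of $v$ is created and any, possibly empty, subset of the children of $v$ becomes the set of its children); cost $d_X(x,0_X)$. - Ghosting a degree $2$ vertex $v$: remove $v$ and join its two adjacent edges, of weights $x,y$, into one edge of weight $x\odot y$; cost $0$. Its inverse is the splitting of an edge (of weight $x\odot y$ into two consecutive edges of weights $x,y\in X\setminus\{0_X\}$); cost $0$. A finite edit path from $T$ to $T'$ is a finite composition of edits transforming $T$ into (a dendrogram isomorphic to) $T'$; its cost is the sum of the costs of its edits; $d_E(T,T')$ is the infimum of the costs of all finite edit paths from $T$ to $T'$. **The set $\mathcal C^*(T,T')$.** A (possibly empty) set $M^*\subset E_T\times E_{T'}$ is in $\mathcal C^*(T,T')$ if, with $\pi_T,\pi_{T'}$ the projections: (A1) any two distinct vertices in $\pi_T(M^* )$ are incomparable in $V_T$, and likewise for $\pi_{T'}(M^* )$ in $V_{T'}$; (A2) $\pi_T$ and $\pi_{T'}$ are injective on $M^*$. **The vertices $\Omega$.** $LCA(x,x')$ is the least common ancestor of $x,x'$, i.e. $\min\{v\in V_T\mid v\ge x,\ v\ge x'\}$. For $x\in\pi_T(M^* )$, $\Omega(x)=\min\{LCA(x,x')\mid x'\in\pi_T(M^* ),\ x'\neq x\}$ if $M^*$ has at least two elements, and $\Omega(x)=r_T$ if $M^*$ is a singleton. Similarly $\Omega(y)$ for $y\in\pi_{T'}(M^* )$. **The partial mapping $\alpha(M^* )$.**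 Let $\mathfrak D,\mathfrak G$ be two symbols (''deletion'', ''ghosting''). $\alpha(M^* )$ consists of: all pairs $(x,y)\in M^*$; the pairs $(v,\mathfrak G)$ for all $v\in E_T$ with $x<v<\Omega(x)$ for some $x\in\pi_T(M^* )$; the pairs $(v,\mathfrak D)$ for all other $v\in E_T\setminus\pi_T(M^* )$ which are not strictly below any $x\in\pi_T(M^* )$; no edit is associated to vertices strictly below some $x\in\pi_T(M^* )$; and symmetrically pairs $(\mathfrak G,w)$, $(\mathfrak D,w)$ for $w\in E_{T'}$. Its cost is the cost of the deletions it contains plus the cost of shrinking, for every $(x,y)\in M^*$, the edge obtained by ghosting the interior of the path from $x$ to $\Omega(x)$ onto the one obtained analogously from the path from $y$ to $\Omega(y)$: $$cost(\alpha(M^* ))=\sum_{(v,\mathfrak D)\in \alpha(M^* )}d_X(\varphi_T(v),0_X)+\sum_{(\mathfrak D,w)\in \alpha(M^* )}d_X(\varphi_{T'}(w),0_X)+\sum_{(x,y)\in M^*}d_X\Big(\bigodot_{x\le v<\Omega(x)}\varphi_T(v),\bigodot_{y\le w<\Omega(y)}\varphi_{T'}(w)\Big).$$ *)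

(* Defs.v *)
From HB Require Import structures.
From mathcomp Require Import all_boot all_order all_algebra.
From mathcomp Require Import all_classical all_reals.

Set Implicit Arguments.
Unset Strict Implicit.
Unset Printing Implicit Defensive.

Import Order.TTheory GRing.Theory Num.Theory.
Local Open Scope ring_scope.

(* The commutative monoid is written additively: x + y is the composition of
   weights and 0 its neutral element. *)
HB.mixin Record Nmodule_isEditable (R : realType) X & GRing.Nmodule X := {
  dX : X -> X -> R ;
  dX_eq0 : forall x y, dX x y = 0 <-> x = y ;
  dX_sym : forall x y, dX x y = dX y x ;
  dX_triangle : forall x y z, dX x z <= dX x y + dX y z ;
  dX0D : forall x y, dX 0 (x + y) = dX 0 x + dX 0 y ;
  (* by commutativity, dX is then also invariant under right translations *)
  dXD2l : forall z x y, dX (z + x) (z + y) = dX x y }.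

#[short(type="editableType")]
HB.structure Definition Editable (R : realType) :=
  { X of GRing.Nmodule X & Nmodule_isEditable R X }.

Lemma dX_ge0 (R : realType) (X : editableType R) (x y : X) :
  0 <= dX x y :> R.
Proof.
have := dX_triangle x y x; rewrite (dX_sym y x) (dX_eq0 x x).2 //.
by rewrite -mulr2n pmulrn_lge0.
Qed.

Lemma editable_add_neq0 (R : realType) (X : editableType R) (x y : X) :
  x != 0 -> x + y != 0.
Proof.
move=> /eqP x0; apply/eqP => xy0; apply: x0; apply/esym/(@dX_eq0 R).
have := dX0D x y; rewrite xy0 (dX_eq0 0 0).2 // => /esym/eqP.
by rewrite paddr_eq0 ?dX_ge0 // => /andP[/eqP].
Qed.

(* A finite rooted tree is given by its parent map, extended by
   parent troot = troot: that the iterates of parent lead every vertex to the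
   root expresses connectedness and acyclicity.  An edge is identified with its
   lower vertex, so that edges are the non-root vertices; the value of weight
   at the root is irrelevant. *)
Record dendrogram (R : realType) (X : editableType R) := Dendrogram {
  vertex :> finType ;
  troot : vertex ;
  parent : vertex -> vertex ;
  weight : vertex -> X ;
  parent_root : parent troot = troot ;
  connect_root : forall v, exists n, iter n parent v = troot ;
  weight_neq0 : forall v, v != troot -> weight v != 0 }.

Arguments troot {R X} d.
Arguments parent {R X} d _.
Arguments weight {R X} d _.

Section VertexOrder.
Variables (R : realType) (X : editableType R) (T : dendrogram X).
Implicit Types (u v x : T) (A : {set T}).

Definition vle x v : bool := fconnect (parent T) x v.
Definition vlt x v : bool := (x != v) && vle x v.

Definition children v : {set T} :=
  [set c | (c != troot T) && (parent T c == v)].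
Definition degree2 v : bool := (v != troot T) && (#|children v| == 1)%N.

(* the least element of P; the default value is only taken if there is none *)
Definition vmin (P : pred T) : T :=
  odflt (troot T) [pick v | P v && [forall u, P u ==> vle v u]].

Definition LCA x x' : T := vmin (fun v => vle x v && vle x' v).

(* A plays the role of the projection of a matching M; on matchings the
   projections are injective, hence #|A| = #|M|. *)
Definition Omega A x : T :=
  if (1 < #|A|)%N then vmin (fun v => v \in [set LCA x x' | x' in A :\ x])
  else troot T.

Definition path_weight A x : X :=
  \sum_(v | vle x v && vlt v (Omega A x)) weight T v.

Definition ghosted A v : bool :=
  (v != troot T) && [exists x in A, vlt x v && vlt v (Omega A x)].

Definition deleted A v : bool :=
  [&& v != troot T, v \notin A, ~~ ghosted A v & ~~ [exists x in A, vlt v x]].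

End VertexOrder.

Definition no_degree2 (R : realType) (X : editableType R)
  (T : dendrogram X) : Prop := forall v : T, ~~ degree2 v.

Definition dendro_iso (R : realType) (X : editableType R) (T T' : dendrogram X) :
    Prop :=
  exists f : T -> T', [/\ bijective f, f (troot T) = troot T',
    forall v, f (parent T v) = parent T' (f v) &
    forall v, v != troot T -> weight T' (f v) = weight T v].

Section Constructions.
Variables (R : realType) (X : editableType R) (T : dendrogram X).

Lemma iter_parent_root n : iter n (parent T) (troot T) = troot T.
Proof. by elim: n => //= n ->; exact: parent_root. Qed.

Lemma parent_neq (v : T) : v != troot T -> parent T v != v.
Proof.
move=> vr; apply/eqP => pv; have [n e] := connect_root v.
have : iter n (parent T) v = v by elim: n {e} => //= n ->.
by rewrite e => rv; rewrite rv eqxx in vr.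
Qed.

Section Sub.
Variable v : T.
Let V := {x : T | vle x v}.
Let rt : V := exist _ v (connect0 (frel (parent T)) v).

Definition sub_parent (x : V) : V :=
  if x == rt then rt else insubd rt (parent T (val x)).

Lemma val_sub_parent x : x != rt -> val (sub_parent x) = parent T (val x).
Proof.
move=> xrt; rewrite /sub_parent (negPf xrt) val_insubd.
suff -> : vle (parent T (val x)) v by [].
have := valP x => /= /iter_findex; case: (findex _ _ _) => [/= e|n].
  by case/eqP: xrt; apply: val_inj.
by rewrite iterSr => e; rewrite /vle -[X in fconnect _ _ X]e fconnect_iter.
Qed.

Lemma sub_parent_root : sub_parent rt = rt.
Proof. by rewrite /sub_parent eqxx. Qed.

Lemma sub_val_root (x : V) : val x = troot T -> x = rt.
Proof.
move=> xr; apply: val_inj; have := valP x => /= /iter_findex.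
by rewrite [sval x]xr iter_parent_root.
Qed.

Lemma sub_connect_root x : exists n, iter n sub_parent x = rt.
Proof.
have [n] := connect_root (val x); elim: n x => [|n IH] x xr.
  by exists 0%N; exact: sub_val_root.
have [->|xrt] := eqVneq x rt; first by exists 0%N.
have [|m em] := IH (sub_parent x); first by rewrite val_sub_parent // -iterSr.
by exists m.+1; rewrite iterSr.
Qed.

Lemma sub_weight_neq0 x : x != rt -> weight T (val x) != 0.
Proof.
move=> xrt; apply: weight_neq0; apply: contra xrt => /eqP xr.
by apply/eqP/sub_val_root.
Qed.

Definition sub_dendrogram : dendrogram X :=
  @Dendrogram R X V rt sub_parent (fun x => weight T (val x))
    sub_parent_root sub_connect_root sub_weight_neq0.

End Sub.

Section Shrink.
Variables (v : T) (y : X) (y0 : y != 0).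

Definition shrink_weight x := if x == v then y else weight T x.

Lemma shrink_weight_neq0 x : x != troot T -> shrink_weight x != 0.
Proof.
by move=> xr; rewrite /shrink_weight; case: ifP => // _; exact: weight_neq0.
Qed.

Definition shrink : dendrogram X :=
  @Dendrogram R X T (troot T) (parent T) shrink_weight
    (parent_root T) (@connect_root R X T) shrink_weight_neq0.

End Shrink.

Section Remove.
Variables (v : T) (vr : v != troot T).
Let V := {x : T | x != v}.

Let root_neq : troot T != v. Proof. by rewrite eq_sym. Qed.
Let rt : V := exist _ (troot T) root_neq.

(* the default value of insubd is never reached, by val_remove_parent *)
Definition remove_parent (x : V) : V :=
  insubd rt (if parent T (val x) == v then parent T v else parent T (val x)).

Lemma val_remove_parent x : val (remove_parent x) =
  if parent T (val x) == v then parent T v else parent T (val x).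
Proof.
rewrite val_insubd ifT //; case: ifPn => // _; exact: parent_neq.
Qed.

Lemma remove_parent_root : remove_parent rt = rt.
Proof.
by apply: val_inj; rewrite val_remove_parent /= parent_root (negPf root_neq).
Qed.

Lemma remove_connect_root x : exists n, iter n remove_parent x = rt.
Proof.
have [n] := connect_root (val x); have [k] := ubnP n.
elim: k n x => // k IH [|n] x; rewrite ?ltnS => nk xr.
  by exists 0%N; apply: val_inj.
suff [m em] : exists m, iter m remove_parent (remove_parent x) = rt.
  by exists m.+1; rewrite iterSr.
rewrite iterSr in xr; have [pv|pv] := eqVneq (parent T (val x)) v; last first.
  by apply: (IH n) => //; rewrite val_remove_parent (negPf pv).
case: n nk xr => [|n] nk; rewrite pv; first by move=> e; case/eqP: (vr).
rewrite iterSr => xr; apply: (IH n); first exact: ltnW.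
by rewrite val_remove_parent pv eqxx.
Qed.

Lemma delete_weight_neq0 (x : V) : x != rt -> weight T (val x) != 0.
Proof.
by move=> xrt; apply: weight_neq0; apply: contra xrt => /eqP e; apply/eqP/val_inj.
Qed.

Definition delete : dendrogram X :=
  @Dendrogram R X V rt remove_parent (fun x => weight T (val x))
    remove_parent_root remove_connect_root delete_weight_neq0.

(* When v has exactly one child, the edge of that child is joined with that
   of v. *)
Definition ghost_weight (x : V) : X :=
  if parent T (val x) == v then weight T (val x) + weight T v
  else weight T (val x).

Lemma ghost_weight_neq0 (x : V) : x != rt -> ghost_weight x != 0.
Proof.
move=> /delete_weight_neq0 x0; rewrite /ghost_weight; case: ifP => // _.
exact: editable_add_neq0.
Qed.

Definition ghost : dendrogram X :=
  @Dendrogram R X V rt remove_parent ghost_weight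
    remove_parent_root remove_connect_root ghost_weight_neq0.

End Remove.

End Constructions.

Section EditDistance.
Variables (R : realType) (X : editableType R).
Implicit Types T : dendrogram X.

(* edit T T' c: a single edit of cost c turns T into a dendrogram isomorphic
   to T'.  Insertions and splittings are the inverses of deletions and
   ghostings. *)
Variant edit T T' : R -> Prop :=
| EditShrink (v : T) (y : X) (_ : v != troot T) (y0 : y != 0)
    (_ : dendro_iso (shrink v y0) T') : edit T T' (dX (weight T v) y)
| EditDelete (v : T) (vr : v != troot T)
    (_ : dendro_iso (delete vr) T') : edit T T' (dX (weight T v) 0)
| EditInsert (v : T') (vr : v != troot T')
    (_ : dendro_iso (delete vr) T) : edit T T' (dX (weight T' v) 0)
| EditGhost (v : T) (vr : v != troot T) (_ : degree2 v)
    (_ : dendro_iso (ghost vr) T') : edit T T' 0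
| EditSplit (v : T') (vr : v != troot T') (_ : degree2 v)
    (_ : dendro_iso (ghost vr) T) : edit T T' 0.

Inductive edit_path : dendrogram X -> dendrogram X -> R -> Prop :=
| PathIso T T' : dendro_iso T T' -> edit_path T T' 0
| PathStep T T1 T' c c' :
    edit T T1 c -> edit_path T1 T' c' -> edit_path T T' (c + c').

(* The set is nonempty (delete every edge of T, then insert those of T') and
   bounded below by 0, so that inf is a genuine infimum. *)
Definition edit_dist T T' : R := inf [set c | edit_path T T' c]%classic.

End EditDistance.

Section Matchings.
Variables (R : realType) (X : editableType R) (T T' : dendrogram X).
Implicit Types M : {set T * T'}.

Definition projl M : {set T} := [set p.1 | p in M].
Definition projr M : {set T'} := [set p.2 | p in M].

Definition incomparable (S : dendrogram X) (A : {set S}) : Prop :=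
  {in A &, forall x x', x != x' -> ~~ vle x x' && ~~ vle x' x}.

Definition matching M : Prop :=
  [/\ {in M, forall p, (p.1 != troot T) && (p.2 != troot T')},
      incomparable (projl M) /\ incomparable (projr M) &
      {in M &, injective (fun p => p.1)} /\
      {in M &, injective (fun p => p.2)}].

Variant edit_symbol := Deletion | Ghosting.

(* The partial mapping alpha M, as a set of pairs; a vertex occurring in no pair
   is one with which no edit is associated. *)
Definition alpha M (a : T + edit_symbol) (b : T' + edit_symbol) : bool :=
  match a, b with
  | inl x, inl y => (x, y) \in M
  | inl v, inr Ghosting => ghosted (projl M) v
  | inl v, inr Deletion => deleted (projl M) v
  | inr Ghosting, inl w => ghosted (projr M) w
  | inr Deletion, inl w => deleted (projr M) w
  | inr _, inr _ => false
  end.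

Definition alpha_cost M : R :=
  \sum_(v | alpha M (inl v) (inr Deletion)) dX (weight T v) 0 +
  \sum_(w | alpha M (inr Deletion) (inl w)) dX (weight T' w) 0 +
  \sum_(p in M) dX (path_weight (projl M) p.1) (path_weight (projr M) p.2).

End Matchings.

(* Main.v *)
Require Import Defs.
From mathcomp Require Import all_boot all_order all_algebra.
From mathcomp Require Import all_classical all_reals.
From mathcomp Require Import lra.

Set Implicit Arguments.
Unset Strict Implicit.
Unset Printing Implicit Defensive.

Import Order.TTheory GRing.Theory Num.Theory.
Local Open Scope ring_scope.

(** The edit distance is first expressed through a global object.  Drop the
    incomparability condition on matchings and call mapping a set of pairs of
    non-root vertices that preserves and reflects the orders of the two trees.
    The owner of a vertex v is the greatest matched vertex below v, if there is
    one.  Owned vertices are ghosted into the edge of their owner and unowned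
    ones are deleted, so that the cost mcost of a mapping is that of these
    deletions plus, for each pair, the distance between the total weights owned
    by its two members.

    The edit distance is the minimum of these costs (edit_dist_min).

    A mapping is realized by an edit path of at most its cost
    (edit_path_mapped): delete unowned vertices; when none is left, an unmatched
    vertex has exactly one child, since two children would have incomparable
    owners, and it can be ghosted; when all vertices are matched in both trees,
    the mapping is an isomorphism up to the weights, which are shrunk one by
    one.

    Conversely, an edit path dominates the cost of some mapping
    (mapped_edit_path): start with the identity at the end of the path and
    transport the mapping back through each edit.  Deleting a vertex amounts to
    replacing its weight by 0, and ghosting it to moving its weight to its
    child, since the order of the remaining vertices is unchanged.  A change of
    weights alters the cost by at most its own cost (le_mcost_weight), and
    moving weight between vertices of the same owner does not alter it
    (mcost_shift).  The difficulty is that a vertex that disappears may be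
    matched: its partner is then given to a neighbour, or its pair is dropped
    (avoid_null, avoid_degree2).

    The theorem follows by cutting a mapping along its maximal pairs.  These
    form a matching, and every matching arises in this way (matching_extends).
    Since a non-root vertex v above x lies strictly below Omega(x) exactly when
    no other matched vertex lies below v (vlt_Omega), ownership above the matching is what alpha
    prescribes; below a matched pair (x, y) the mapping is one between the
    subtrees at x and y.  The cost splits accordingly (mcost_alpha), so that it
    can be minimized separately below each pair of the matching. *)

(** * The order of a rooted tree *)

Section TreeOrder.
Variables (R : realType) (X : editableType R) (T : dendrogram X).
Implicit Types u v x : T.

Lemma vleP u v : reflect (exists n, iter n (parent T) u = v) (vle u v).
Proof.
apply: (iffP idP) => [uv|[n <-]]; last exact: fconnect_iter.
by exists (findex (parent T) u v); exact: iter_findex.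
Qed.

Lemma vle_refl v : vle v v.
Proof. exact: connect0. Qed.

Lemma vle_trans u v x : vle u v -> vle v x -> vle u x.
Proof. exact: connect_trans. Qed.

Lemma vle_parent v : vle v (parent T v).
Proof. exact: fconnect1. Qed.

Lemma vle_root v : vle v (troot T).
Proof. by have [n e] := Defs.connect_root v; apply/vleP; exists n. Qed.

Lemma root_vle v : vle (troot T) v -> v = troot T.
Proof. by case/vleP => n <-; rewrite iter_parent_root. Qed.

(** Following the parent map around a cycle also leads to the root, which is a
    fixed point. *)
Lemma vle_anti u v : vle u v -> vle v u -> u = v.
Proof.
case/vleP => n nv /vleP[m mu].
have [n0|n0] := posnP (m + n); first by move: nv mu n0; case: n; case: m => //=.
have cyc k : iter (k * (m + n)) (parent T) u = u.
  by elim: k => // k IH; rewrite mulSn iterD IH iterD nv.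
have [k rk] := Defs.connect_root u.
suff ur : u = troot T by rewrite -nv ur iter_parent_root.
have le_k : (k <= k * (m + n))%N by rewrite leq_pmulr.
by rewrite -(cyc k) -(subnK le_k) iterD rk iter_parent_root.
Qed.

Lemma vle_eqVparent u v : vle u v = (u == v) || vle (parent T u) v.
Proof.
apply/idP/orP => [/vleP[[|n] e]|[/eqP->|]].
- by left; apply/eqP.
- by right; apply/vleP; exists n; rewrite -iterSr.
- exact: vle_refl.
- exact/vle_trans/vle_parent.
Qed.

Lemma parent_vle u v : u != v -> vle u v -> vle (parent T u) v.
Proof. by move=> uv; rewrite vle_eqVparent (negPf uv). Qed.

Lemma vle_total x u v : vle x u -> vle x v -> vle u v || vle v u.
Proof.
move=> /vleP[n <-] /vleP[m <-]; apply/orP.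
have [le_nm|/ltnW le_mn] := leqP n m; [left|right]; apply/vleP.
  by exists (m - n)%N; rewrite -iterD subnK.
by exists (n - m)%N; rewrite -iterD subnK.
Qed.

End TreeOrder.

(** * Metric inequalities in an editable space *)

Section Metric.
Variables (R : realType) (X : editableType R).
Implicit Types a b c e : X.

Lemma dXxx a : dX a a = 0 :> R.
Proof. exact/dX_eq0. Qed.

Lemma dXDD a b c e : dX (a + b) (c + e) <= dX a c + dX b e :> R.
Proof.
apply: (le_trans (dX_triangle _ (c + b) _)).
by rewrite dXD2l (addrC a) (addrC c) dXD2l.
Qed.

Lemma dXD0 a b : dX (a + b) 0 = dX a 0 + dX b 0 :> R.
Proof. by rewrite !(dX_sym _ 0) dX0D. Qed.

Lemma le_dX_sum (I : Type) (r : seq I) (P : pred I) (F G : I -> X) :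
  dX (\sum_(i <- r | P i) F i) (\sum_(i <- r | P i) G i)
    <= \sum_(i <- r | P i) dX (F i) (G i) :> R.
Proof.
elim: r => [|i r IH]; first by rewrite !big_nil dXxx.
rewrite !big_cons; case: (P i) => //.
by apply: le_trans (dXDD _ _ _ _) _; rewrite lerD2l.
Qed.

Lemma dX_sum0 (I : Type) (r : seq I) (P : pred I) (F : I -> X) :
  dX (\sum_(i <- r | P i) F i) 0 = \sum_(i <- r | P i) dX (F i) 0 :> R.
Proof.
elim: r => [|i r IH]; first by rewrite !big_nil dXxx.
by rewrite !big_cons; case: (P i) => //; rewrite dXD0 IH.
Qed.

End Metric.

(** * Owners of vertices *)

Section Owners.
Variables (R : realType) (X : editableType R) (T : dendrogram X).
Variable I : finType.
Implicit Types (pi : I -> T) (M : {set I}) (w : T -> X) (p q : I) (v : T).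

(** The marked vertices are the pi p for p in M.  They are designated by their
    indices because a pair of a mapping marks a vertex in each of two trees. *)
Definition owns pi M p v : bool :=
  [&& p \in M, vle (pi p) v & [forall q in M, vle (pi q) v ==> vle (pi q) (pi p)]].

Definition unowned pi M v : bool := [forall p, ~~ owns pi M p v].

Definition loss w pi M : R := \sum_(v | unowned pi M v) dX (w v) 0.

Definition segment w pi M p : X := \sum_(v | owns pi M p v) w v.

Lemma ownsP pi M p v :
  reflect [/\ p \in M, vle (pi p) v &
             forall q, q \in M -> vle (pi q) v -> vle (pi q) (pi p)]
          (owns pi M p v).
Proof.
apply: (iffP and3P) => [[pM pv /forall_inP h]|[pM pv h]]; split=> //.
  by move=> q /h /implyP.
by apply/forall_inP => q /h /implyP.
Qed.

Lemma owns_mem pi M p v : owns pi M p v -> p \in M.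
Proof. by case/and3P. Qed.

Lemma unownedPn pi M v : reflect (exists p, owns pi M p v) (~~ unowned pi M v).
Proof.
rewrite negb_forall; apply: (iffP existsP) => -[p]; rewrite ?negbK => h;
by exists p; rewrite ?negbK.
Qed.

Lemma unowned_owns pi M p v : unowned pi M v -> owns pi M p v = false.
Proof. by move/forallP/(_ p)/negPf. Qed.

Lemma owns_self pi M p : p \in M -> owns pi M p (pi p).
Proof. by move=> pM; apply/ownsP; split=> //; exact: vle_refl. Qed.

Lemma owns_ext pi M u v : (forall q, q \in M -> vle (pi q) u = vle (pi q) v) ->
  owns pi M ^~ u =1 owns pi M ^~ v.
Proof.
move=> uv p; apply/ownsP/ownsP => -[pM pu h]; split=> //.
- by rewrite -uv.
- by move=> q qM; rewrite -uv //; exact: h.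
- by rewrite uv.
- by move=> q qM; rewrite uv //; exact: h.
Qed.

Lemma eq_unowned pi M u v : owns pi M ^~ u =1 owns pi M ^~ v ->
  unowned pi M u = unowned pi M v.
Proof. by move=> uv; apply: eq_forallb => p; rewrite uv. Qed.

(** Two marked vertices that own the same vertex lie below each other, so that
    owners are unique. *)
Section Partition.
Variables (pi : I -> T) (M : {set I}).
Hypothesis pi_inj : {in M &, injective pi}.

Lemma owns_uniq p q v : owns pi M p v -> owns pi M q v -> p = q.
Proof.
move=> /ownsP[pM pv hp] /ownsP[qM qv hq]; apply: pi_inj => //.
by apply: vle_anti; [exact: hq | exact: hp].
Qed.

Lemma sum_owners (V : nmodType) (F : T -> V) :
  \sum_(v | unowned pi M v) F v + \sum_(p in M) \sum_(v | owns pi M p v) F v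
  = \sum_v F v.
Proof.
rewrite (exchange_big_dep xpredT) //= [RHS](bigID (unowned pi M)) /=.
congr (_ + _); rewrite [LHS](bigID (unowned pi M)) /=.
rewrite big1 ?add0r => [|v uv]; last first.
  by rewrite big1 // => p /andP[_]; rewrite unowned_owns.
apply: eq_bigr => v /unownedPn[p pv]; rewrite (big_pred1 p) // => q.
apply/andP/eqP => [[_ qv]|->]; first exact: owns_uniq qv pv.
by split=> //; exact: owns_mem pv.
Qed.

(** Here O assigns to each index vertices that it claims to own; the claims have
    to be justified only where the weight is nonzero.  By the triangle
    inequality, a segment can be cut down to the claimed vertices if the
    distance to 0 of the others is paid for, and this makes them as costly as
    unowned vertices. *)
Section Relax.
Variables (w : T -> X) (O : I -> pred T).
Hypothesis O_owns : forall p v, p \in M -> w v != 0 -> O p v -> owns pi M p v.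

Definition slack p : R := \sum_(v | owns pi M p v && ~~ O p v) dX (w v) 0.

Lemma dX_segment_slack p : p \in M ->
  dX (segment w pi M p) (\sum_(v | O p v) w v) <= slack p.
Proof.
move=> pM; rewrite /segment (bigID (O p)) /= addrC.
have -> : \sum_(v | O p v) w v = 0 + \sum_(v | owns pi M p v && O p v) w v.
  rewrite add0r [LHS](bigID (owns pi M p)) /= [X in _ + X]big1 ?addr0.
    by apply: eq_bigl => v; rewrite andbC.
  move=> v /andP[Ov]; apply: contraNeq => wv; exact: O_owns.
by apply: le_trans (dXDD _ _ _ _) _; rewrite dXxx addr0 dX_sum0.
Qed.

Lemma loss_slack : loss w pi M + \sum_(p in M) slack p
  <= \sum_(v | ~~ [exists p in M, O p v]) dX (w v) 0.
Proof.
pose F v : R := if [exists p in M, O p v] then 0 else dX (w v) 0.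
have -> : \sum_(v | ~~ [exists p in M, O p v]) dX (w v) 0 = \sum_v F v.
  by rewrite big_mkcond; apply: eq_bigr => v _; rewrite /F if_neg.
rewrite -sum_owners; apply: lerD.
  apply: ler_sum => v uv; rewrite /F; case: ifPn => // /exists_inP[p pM Op].
  have [->|/O_owns] := eqVneq (w v) 0; first by rewrite dXxx.
  by move/(_ _ pM Op); rewrite unowned_owns.
apply: ler_sum => p pM; rewrite /slack big_mkcondr /=.
apply: ler_sum => v pv; rewrite /F; case: exists_inP => [[q qM Oq]|nO]; last first.
  by case: ifP => // _; exact: dX_ge0.
case: ifP => // nO; have [->|/O_owns] := eqVneq (w v) 0; first by rewrite dXxx.
by move/(_ _ qM Oq) => /owns_uniq /(_ pv) qp; rewrite -qp Oq in nO.
Qed.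

End Relax.
End Partition.
End Owners.

(** * Mappings between two trees and their cost *)

Section Mappings.
Variables (R : realType) (X : editableType R) (T T' : dendrogram X).
Variable I : finType.
Implicit Types (M : {set I}) (pi : I -> T) (rho : I -> T').
Implicit Types (w : T -> X) (z : T' -> X).

(** The pairs (pi p, rho p) are indexed by p in an arbitrary finite type: the image
    of a mapping under a map between trees is then a mere composition. *)
Definition mapping pi rho M : Prop :=
  [/\ {in M &, forall p q, vle (pi p) (pi q) = vle (rho p) (rho q)},
      {in M &, injective pi} &
      {in M, forall p, (pi p != troot T) && (rho p != troot T')}].

Definition mcost w z pi rho M : R :=
  loss w pi M + loss z rho M +
  \sum_(p in M) dX (segment w pi M p) (segment z rho M p).

Lemma mapping_inj_r pi rho M : mapping pi rho M -> {in M &, injective rho}.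
Proof.
move=> [le_pi inj _] p q pM qM e; apply: inj => //.
by apply: vle_anti; rewrite le_pi // e vle_refl.
Qed.

Lemma mapping_sub pi rho M M' :
  M' \subset M -> mapping pi rho M -> mapping pi rho M'.
Proof.
by move=> /fintype.subsetP s [le_pi inj nr]; split=> [p q|p q|p] /s pM;
  [move=> /s; exact: le_pi | move=> /s; exact: inj | exact: nr].
Qed.

Lemma unownedE (S : dendrogram X) (pi : I -> S) M v :
  unowned pi M v = ~~ [exists p in M, owns pi M p v].
Proof.
apply/idP/idP => [u|/exists_inP n].
  by apply/exists_inP => -[p _]; rewrite unowned_owns.
apply: contra_notT n => /unownedPn[p pv]; exists p => //; exact: owns_mem pv.
Qed.

(** Ghosting is never more expensive than deleting: owned vertices may be
    accounted for as deleted.  The costs of two mappings are compared by claiming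
    for one of them what the other owns. *)
Lemma mcost_relax w z pi rho M (O : I -> pred T) (O' : I -> pred T') :
    mapping pi rho M ->
    (forall p v, p \in M -> w v != 0 -> O p v -> owns pi M p v) ->
    (forall p v, p \in M -> z v != 0 -> O' p v -> owns rho M p v) ->
  mcost w z pi rho M <=
    \sum_(v | ~~ [exists p in M, O p v]) dX (w v) 0 +
    \sum_(v | ~~ [exists p in M, O' p v]) dX (z v) 0 +
    \sum_(p in M) dX (\sum_(v | O p v) w v) (\sum_(v | O' p v) z v).
Proof.
move=> mM OM OM'; have [_ inj _] := mM; have inj' := mapping_inj_r mM.
have l := loss_slack inj OM; have l' := loss_slack inj' OM'.
have : \sum_(p in M) dX (segment w pi M p) (segment z rho M p) <=
    \sum_(p in M) slack pi M w O p + \sum_(p in M) slack rho M z O' p +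
    \sum_(p in M) dX (\sum_(v | O p v) w v) (\sum_(v | O' p v) z v).
  rewrite -!big_split; apply: ler_sum => p pM /=.
  have s := dX_segment_slack OM pM; have s' := dX_segment_slack OM' pM.
  apply: le_trans (dX_triangle _ (\sum_(v | O p v) w v) _) _.
  rewrite -addrA lerD // addrC.
  apply: le_trans (dX_triangle _ (\sum_(v | O' p v) z v) _) _.
  by rewrite lerD2l dX_sym.
move=> h; rewrite /mcost; apply: le_trans (lerD (lexx _) h) _.
by rewrite addrA lerD2r addrACA lerD.
Qed.

(** Each vertex contributes to one deletion or to one segment only. *)
Lemma le_mcost_weight w w2 z pi rho M : {in M &, injective pi} ->
  mcost w2 z pi rho M <= mcost w z pi rho M + \sum_v dX (w2 v) (w v).
Proof.
move=> inj; rewrite -(sum_owners inj) /mcost.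
have -> (a b c e f : R) : a + b + c + (e + f) = a + e + b + (f + c).
  by rewrite addrACA [c + f]addrC (addrAC a).
apply: lerD; first rewrite lerD2r -big_split; first apply: ler_sum => v _ /=.
  by rewrite addrC; exact: dX_triangle.
rewrite -big_split; apply: ler_sum => p _ /=.
apply: le_trans (dX_triangle _ (segment w pi M p) _) _.
by rewrite lerD2r; exact: le_dX_sum.
Qed.

Definition reset w v : T -> X := fun u => if u == v then 0 else w u.

Lemma sum_dX_reset w v : \sum_u dX (reset w v u) (w u) = dX 0 (w v) :> R.
Proof.
rewrite (bigD1 v) //= /reset eqxx big1 ?addr0 // => u /negPf ->; exact: dXxx.
Qed.

Lemma mcost_unowned w z pi rho M v : unowned pi M v ->
  dX (w v) 0 + mcost (reset w v) z pi rho M = mcost w z pi rho M.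
Proof.
move=> uv; rewrite /mcost !addrA; congr (_ + _ + _).
  rewrite /loss [RHS](bigD1 v) //= [X in _ + X](bigD1 v) //=.
  rewrite {1}/reset eqxx dXxx add0r; congr (_ + _).
  by apply: eq_bigr => u /andP[_ /negPf uv']; rewrite /reset uv'.
apply: eq_bigr => p _; congr dX; apply: eq_bigr => u pu; rewrite /reset.
by case: eqP => // e; rewrite e unowned_owns in pu.
Qed.

Definition shift w v c : T -> X :=
  fun u => if u == v then 0 else if u == c then w u + w v else w u.

Lemma sum_shift (V : nmodType) (F : X -> V) (P : pred T) w v c :
    v != c -> P v = P c -> F 0 = 0 ->
    F (w c + w v) = F (w c) + F (w v) ->
  \sum_(u | P u) F (shift w v c u) = \sum_(u | P u) F (w u).
Proof.
move=> vc Pvc F0 FD; rewrite /shift; have [Pv|nPv] := boolP (P v); last first.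
  apply: eq_bigr => u Pu; case: eqP => [e|_]; first by rewrite -e Pu in nPv.
  by case: eqP => // e; rewrite Pvc -e Pu in nPv.
rewrite [LHS](bigD1 v) // [RHS](bigD1 v) //= eqxx F0 add0r.
rewrite [LHS](bigD1 c) -?Pvc ?Pv 1?eq_sym //=.
rewrite [X in _ = _ + X](bigD1 c) -?Pvc ?Pv 1?eq_sym //=.
rewrite eq_sym (negPf vc) eqxx FD addrA [F (w c) + _]addrC; congr (_ + _).
by apply: eq_bigr => u /andP[/andP[_ /negPf ->] /negPf ->].
Qed.

(** If v and c are unowned, this is the additivity of the distance to 0. *)
Lemma mcost_shift w z pi rho M v c :
    v != c -> owns pi M ^~ v =1 owns pi M ^~ c ->
  mcost (shift w v c) z pi rho M = mcost w z pi rho M.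
Proof.
move=> vc own; rewrite /mcost; congr (_ + _ + _).
  apply: (sum_shift (F := fun x => dX x 0)) => //.
  - exact: eq_unowned.
  - exact: dXxx.
  - exact: dXD0.
by apply: eq_bigr => p _; congr dX; exact: (sum_shift (F := id)).
Qed.

(** * Replacing or dropping a pair of a mapping *)

(** The partner of pi p0 is given to u.  The third comparison needs to hold only
    at owned vertices of nonzero weight: no claim is made on the others. *)
Lemma mcost_move w z pi rho M p0 u (pi2 := [eta pi with p0 |-> u]) :
    mapping pi rho M -> p0 \in M -> u != troot T ->
    (forall q, q \in M -> q != p0 -> vle (pi q) u = vle (pi q) (pi p0)) ->
    (forall q, q \in M -> q != p0 -> vle u (pi q) = vle (pi p0) (pi q)) ->
    (forall s, w s != 0 -> ~~ unowned pi M s -> vle u s = vle (pi p0) s) ->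
  mapping pi2 rho M /\ mcost w z pi2 rho M <= mcost w z pi rho M.
Proof.
move=> mM p0M ur le_u u_le Hs; have [le_pi inj nr] := mM.
have le2 : {in M &, forall p q, vle (pi2 p) (pi2 q) = vle (pi p) (pi q)}.
  move=> p q pM qM; rewrite /pi2 /=.
  case: (eqVneq p p0) => [->|pp]; case: (eqVneq q p0) => [->|qp] //.
  - by rewrite !vle_refl.
  - exact: u_le.
  - exact: le_u.
have m2 : mapping pi2 rho M.
  split=> [p q pM qM|p q pM qM e|p pM].
  - by rewrite le2 // le_pi.
  - by apply: inj => //; apply: vle_anti; rewrite -le2 // e vle_refl.
  - rewrite /pi2 /=; case: (eqVneq p p0) => [->|_]; last exact: nr.
    by case/andP: (nr _ p0M) => _ ->; rewrite ur.
split=> //; apply: le_trans (mcost_relax (O := owns pi M) (O' := owns rho M) m2 _ _) _.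
- move=> p s pM ws own; case/ownsP: (own) => _ ps hp.
  have sE q : q \in M -> vle (pi2 q) s = vle (pi q) s.
    move=> qM; rewrite /pi2 /=; case: (eqVneq q p0) => // ->; apply: Hs => //.
    by apply/unownedPn; exists p.
  by apply/ownsP; split=> // [|q qM]; rewrite sE // => qs; rewrite le2 // hp.
- by [].
- by rewrite /mcost lerD2r /loss; under eq_bigl do rewrite -unownedE;
  rewrite lerD2l; under eq_bigl do rewrite -unownedE.
Qed.

Lemma owns_setD1 (S : dendrogram X) (pi : I -> S) M p0 p v :
  p != p0 -> owns pi M p v -> owns pi (M :\ p0) p v.
Proof.
move=> pp /ownsP[pM pv hp]; apply/ownsP; split; rewrite ?in_setD1 ?pp //.
by move=> q /setD1P[_]; exact: hp.
Qed.

Lemma sum_disowned (S : dendrogram X) (pi : I -> S) M p0 (F : S -> R) :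
    {in M &, injective pi} -> p0 \in M ->
  \sum_(v | ~~ [exists p in M :\ p0, owns pi M p v]) F v =
  \sum_(v | unowned pi M v) F v + \sum_(v | owns pi M p0 v) F v.
Proof.
move=> inj p0M; rewrite (bigID (unowned pi M)) /=; congr (_ + _).
  apply: eq_bigl => v; rewrite andb_idl // => uv.
  by apply/exists_inP => -[p _]; rewrite unowned_owns.
apply: eq_bigl => v; apply/andP/idP => [[/exists_inP n /unownedPn[p pv]]|pv].
  case: (eqVneq p p0) => [<- //|pp]; case: n; exists p => //.
  by rewrite in_setD1 pp (owns_mem pv).
split; last by apply/unownedPn; exists p0.
apply/exists_inP => -[p /setD1P[/eqP pp _] qv]; apply: pp.
exact: (owns_uniq inj qv pv).
Qed.

(** What p0 owned is accounted for as deleted, in both trees. *)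
Lemma mcost_drop w z pi rho M p0 : mapping pi rho M -> p0 \in M ->
  mcost w z pi rho (M :\ p0)
    + dX (segment w pi M p0) (segment z rho M p0) <=
  mcost w z pi rho M + dX (segment w pi M p0) 0 + dX (segment z rho M p0) 0.
Proof.
move=> mM p0M; have mM' := mapping_sub (subD1set M p0) mM.
have [_ inj _] := mM; have inj' := mapping_inj_r mM.
have relax := mcost_relax (O := owns pi M) (O' := owns rho M) mM'.
apply: le_trans (lerD (relax _ _ _ _) (lexx _)) _.
- by move=> p v /setD1P[pp _] _; exact: owns_setD1.
- by move=> p v /setD1P[pp _] _; exact: owns_setD1.
rewrite !sum_disowned // /mcost [in leRHS](big_setD1 p0) //= ![in leRHS]dX_sum0.
rewrite /loss; lra.
Qed.

(** The segments of p0 are appended to those of p1, and the distance between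
    sums is at most the sum of the distances. *)
Lemma mcost_merge w z pi rho M p0 p1 :
    mapping pi rho M -> p0 \in M -> p1 \in M -> p1 != p0 ->
    (forall s, owns pi M p0 s -> owns pi (M :\ p0) p1 s) ->
    (forall s, owns rho M p0 s -> owns rho (M :\ p0) p1 s) ->
  mcost w z pi rho (M :\ p0) <= mcost w z pi rho M.
Proof.
move=> mM p0M p1M p10 h h'; have mM' := mapping_sub (subD1set M p0) mM.
have [_ inj _] := mM; have inj' := mapping_inj_r mM.
pose O (S : dendrogram X) (pi : I -> S) p v :=
  owns pi M p v || (p == p1) && owns pi M p0 v.
have noO (S : dendrogram X) (f : I -> S) v :
    ~~ [exists p in M :\ p0, O S f p v] = unowned f M v.
  rewrite unownedE; congr negb; apply/exists_inP/exists_inP.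
    by move=> [p /setD1P[pp pM] /orP[?|/andP[_ ?]]]; [exists p|exists p0].
  move=> [p pM own]; have [e|pp] := eqVneq p p0.
    by exists p1; rewrite ?in_setD1 ?p10 // /O eqxx -e own orbT.
  by exists p; rewrite ?in_setD1 ?pp // /O own.
have sumO (S : dendrogram X) (f : I -> S) (v : S -> X) : {in M &, injective f} ->
    \sum_(s | O S f p1 s) v s = segment v f M p1 + segment v f M p0.
  move=> f_inj; rewrite (bigID (owns f M p1)) /= /O eqxx; congr (_ + _).
    by apply: eq_bigl => s; case: (owns f M p1 s); rewrite ?andbF.
  apply: eq_bigl => s; case: (boolP (owns f M p1 s)) => o1 /=; rewrite ?andbT //.
  by apply/esym/negP => o0; case/eqP: p10; exact: owns_uniq o1 o0.
apply: le_trans (mcost_relax (O := O T pi) (O' := O T' rho) mM' _ _) _.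
- move=> p s /setD1P[pp _] _ /orP[|/andP[/eqP->]]; [exact: owns_setD1|exact: h].
- move=> p s /setD1P[pp _] _ /orP[|/andP[/eqP->]]; [exact: owns_setD1|exact: h'].
under eq_bigl do rewrite noO; rewrite /mcost /loss -!addrA lerD2l.
under eq_bigl do rewrite noO; rewrite lerD2l.
have p1M' : p1 \in M :\ p0 by rewrite in_setD1 p10.
rewrite [leRHS](big_setD1 p0) // [leRHS]addrC !(big_setD1 p1 p1M') /= [leRHS]addrAC.
apply: lerD; first by rewrite !sumO //; exact: dXDD.
rewrite le_eqVlt; apply/orP; left; apply/eqP.
apply: eq_bigr => p /setD1P[/negPf pp _].
by congr dX; apply: eq_bigl => s; rewrite /O pp orbF.
Qed.

(** A vertex v of weight 0 need not be matched.  If v owns its parent, and this is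
    not the root, then the parent takes over the partner of v.  Otherwise, as v would own its parent if
    it owned any vertex above, it owns only itself and possibly the root: the
    segment of its partner is then matched with 0, and deleting it costs the
    same. *)
Lemma avoid_null w z pi rho M v :
    mapping pi rho M -> v != troot T -> w v = 0 -> w (troot T) = 0 ->
  exists pi2 M2, [/\ mapping pi2 rho M2, {in M2, forall p, pi2 p != v} &
    mcost w z pi2 rho M2 <= mcost w z pi rho M].
Proof.
move=> mM vr wv wr; have [le_pi inj nr] := mM.
have [/exists_inP[p0 p0M /eqP pv]|/exists_inP n] := boolP [exists p in M, pi p == v];
  last by exists pi, M; split=> // p pM; apply/negP => e; case: n; exists p.
have [/andP[ur /ownsP[_ _ hu]]|nu] :=
    boolP ((parent T v != troot T) && owns pi M p0 (parent T v)).
  have [] := @mcost_move w z pi rho M p0 (parent T v) mM p0M ur.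
  - move=> q qM _; apply/idP/idP => [|h]; first exact: hu.
    by apply: vle_trans h _; rewrite pv; exact: vle_parent.
  - move=> q qM qp; rewrite pv [RHS]vle_eqVparent orb_idl // => /eqP e.
    by case/eqP: qp; apply: inj => //; rewrite pv.
  - move=> s ws _; rewrite pv [RHS]vle_eqVparent orb_idl // => /eqP e.
    by rewrite -e wv eqxx in ws.
  move=> m2 c2; exists [eta pi with p0 |-> parent T v], M; split=> // p pM /=.
  case: (eqVneq p p0) => [_|pp]; first exact: parent_neq.
  by apply: contra pp => /eqP e; apply/eqP/inj; rewrite ?pv.
have seg0 : segment w pi M p0 = 0.
  rewrite /segment big1 // => s /ownsP[_ ps hs]; rewrite pv in ps.
  have [<- //|vs] := eqVneq v s; have us := parent_vle vs ps.
  suff : parent T v = troot T by move=> ur; rewrite ur in us; rewrite (root_vle us).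
  apply/eqP; apply: contraR nu => ->; apply/ownsP; split=> //.
    by rewrite pv vle_parent.
  by move=> q qM qu; apply: hs => //; exact: vle_trans us.
exists pi, (M :\ p0); split.
- by apply: mapping_sub mM; exact: subD1set.
- move=> p /setD1P[pp pM]; apply: contra pp => /eqP e.
  by apply/eqP/inj; rewrite ?pv.
- have := mcost_drop w z mM p0M.
  by rewrite seg0 dXxx addr0 (dX_sym 0) lerD2r.
Qed.

Lemma vle_children (u v : T) : vle u v -> u != v ->
  exists2 c, c \in children v & vle u c.
Proof.
case/vleP => n; elim: n u => [|n IH] u /=; first by move=> ->; rewrite eqxx.
rewrite -iterS iterSr => nu uv; have [pu|pu] := eqVneq (parent T u) v; last first.
  by have [c cv uc] := IH _ nu pu; exists c => //; exact: vle_trans (vle_parent u) uc.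
exists u; last exact: vle_refl.
rewrite inE pu eqxx andbT; apply: contra uv => /eqP ur.
by rewrite -pu ur parent_root.
Qed.

(** The last clause says that a marked vertex below v is below c, unless it is v
    itself: this is what makes v and c have the same owner once v is unmatched. *)
Lemma degree2P (v : T) : degree2 v ->
  exists c, [/\ v != troot T, children v = [set c], v != c, parent T c = v &
    forall u, vle u c = vle u v && (u != v)].
Proof.
case/andP => vr /cards1P[c cE]; exists c.
have : c \in children v by rewrite cE set11.
rewrite inE => /andP[cr /eqP pc].
have vc : v != c by rewrite -pc; exact: parent_neq.
split=> // u; apply/idP/andP => [uc|[uv nuv]].
  split; first by rewrite -pc; exact/(vle_trans uc)/vle_parent.
  apply: contraNneq vc => e; apply/eqP/vle_anti; first by rewrite -e.
  by rewrite -pc vle_parent.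
by have [c'] := vle_children uv nuv; rewrite cE inE => /eqP ->.
Qed.

(** If the child c of a degree 2 vertex v is unowned, then the partner of v is
    given to c, at the price of extending a segment by the deleted weight of c.
    Otherwise the owner of c takes over the segment of v, and its partner that
    of the partner of v. *)
Lemma avoid_degree2 w z pi rho M v :
    mapping pi rho M -> degree2 v ->
  exists pi2 M2, [/\ mapping pi2 rho M2, {in M2, forall p, pi2 p != v} &
    mcost w z pi2 rho M2 <= mcost w z pi rho M].
Proof.
move=> mM d2; have [c [vr _ vc pc le_c]] := degree2P d2; have [le_pi inj nr] := mM.
have [/exists_inP[p0 p0M /eqP pv]|/exists_inP n] := boolP [exists p in M, pi p == v];
  last by exists pi, M; split=> // p pM; apply/negP => e; case: n; exists p.
have neqv q : q \in M -> q != p0 -> pi q != v.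
  by move=> qM; apply: contra => /eqP e; apply/eqP/inj; rewrite ?pv.
have [uc|/unownedPn[p1 own1]] := boolP (unowned pi M c).
  have cpi q : q \in M -> c != pi q.
    move=> qM; apply: contraTneq uc => ->; apply/unownedPn; exists q.
    exact: owns_self.
  have cr : c != troot T.
    by apply: contraNneq vr => e; rewrite -pc e parent_root.
  have [] := @mcost_move w z pi rho M p0 c mM p0M cr.
  - by move=> q qM qp; rewrite le_c pv neqv ?andbT.
  - by move=> q qM qp; rewrite vle_eqVparent (negPf (cpi _ _)) //= pc pv.
  - move=> s _ us; rewrite vle_eqVparent pc pv orb_idl // => /eqP e.
    by rewrite -e uc in us.
  move=> m2 c2; exists [eta pi with p0 |-> c], M; split=> // p pM /=.
  by case: (eqVneq p p0) => [_|pp]; [rewrite eq_sym | exact: neqv].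
have /ownsP[p1M p1c h1] := own1.
have p10 : p1 != p0.
  by move: p1c; rewrite le_c => /andP[_]; apply: contra => /eqP ->; rewrite pv.
have below q : q \in M -> q != p0 -> vle (pi q) v -> vle (pi q) (pi p1).
  by move=> qM qp qv; apply: h1 => //; rewrite le_c qv neqv.
have p1v : vle (pi p1) (pi p0) by rewrite pv; move: p1c; rewrite le_c => /andP[].
exists pi, (M :\ p0); split.
- by apply: mapping_sub mM; exact: subD1set.
- by move=> p /setD1P[pp pM]; exact: neqv.
apply: (@mcost_merge _ _ _ _ _ p0 p1) => // s /ownsP[_ ps hs]; apply/ownsP.
- split; rewrite ?in_setD1 ?p10 //; first exact: vle_trans ps.
  by move=> q /setD1P[qp qM] /hs qs; apply: below => //; rewrite -pv qs.
- split; rewrite ?in_setD1 ?p10 //; first by apply: vle_trans ps; rewrite -le_pi.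
  move=> q /setD1P[qp qM] /hs qs; rewrite -le_pi // below // -pv le_pi //; exact: qs.
Qed.

End Mappings.

(** * Embeddings of trees *)

Section Embeddings.
Variables (R : realType) (X : editableType R).
Implicit Types S T : dendrogram X.

(** With weight 0, the root can take part in all sums without contributing. *)
Definition wt T (v : T) : X := if v == troot T then 0 else weight T v.
Arguments wt : clear implicits.

(** Both a contracted tree and a subtree consist of some vertices of T with the
    induced order.  Costs in such a tree S are costs in T for a weight function w
    that vanishes outside S. *)
Definition embedding S T (f : S -> T) (w : T -> X) : Prop :=
  [/\ forall a b, vle (f a) (f b) = vle a b,
      forall v, v \notin codom f -> w v = 0 & forall s, w (f s) = wt S s].

Lemma embedding_inj S T (f : S -> T) w : embedding f w -> injective f.
Proof. by move=> [fle _ _] a b e; apply: vle_anti; rewrite -fle e vle_refl. Qed.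

Lemma embedding_id T : embedding (@id T) (wt T).
Proof. by split=> // v; rewrite -[v in v \notin _]/(id v) codom_f. Qed.

Lemma sum_embedding S T (f : S -> T) w (V : nmodType) (F : X -> V) (P : pred T) :
    embedding f w -> F 0 = 0 ->
  \sum_(v | P v) F (w v) = \sum_(s | P (f s)) F (wt S s).
Proof.
move=> ef F0; have [_ w0 wf] := ef; rewrite (bigID (mem (codom f))) /=.
rewrite [X in _ + X]big1 ?addr0 => [|v /andP[_ /w0 ->]] //.
pose D := [set s | P (f s)].
rewrite (eq_bigl (mem (f @: D))) => [|v].
  rewrite big_imset => [|a b _ _] /=; last exact: embedding_inj ef _ _.
  by apply: eq_big => [s|s _]; rewrite ?inE ?wf.
apply/andP/imsetP => [[Pv /codomP[s e]]|[s + ->]].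
  by exists s; rewrite // inE -e.
by rewrite inE codom_f.
Qed.

Lemma owns_embedding S T (f : S -> T) w (I : finType) (pi : I -> S) M p v :
  embedding f w -> owns (f \o pi) M p (f v) = owns pi M p v.
Proof.
move=> [fle _ _]; rewrite /owns /= fle; congr [&& _, _ & _].
by apply: eq_forallb => q; rewrite !fle.
Qed.

Lemma loss_embedding S T (f : S -> T) w (I : finType) (pi : I -> S) M :
  embedding f w -> loss w (f \o pi) M = loss (wt S) pi M.
Proof.
move=> ef; rewrite /loss (sum_embedding (F := fun x => dX x 0) _ ef) ?dXxx //.
apply: eq_bigl => s; apply: eq_forallb => p; congr negb; exact: owns_embedding ef.
Qed.

Lemma segment_embedding S T (f : S -> T) w (I : finType) (pi : I -> S) M p :
  embedding f w -> segment w (f \o pi) M p = segment (wt S) pi M p.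
Proof.
move=> ef; rewrite /segment (sum_embedding (F := id) _ ef) //.
apply: eq_bigl => s; exact: owns_embedding ef.
Qed.

Lemma mcost_embedding S T S' T' (f : S -> T) (g : S' -> T') w z
    (I : finType) (pi : I -> S) (rho : I -> S') M :
  embedding f w -> embedding g z ->
  mcost w z (f \o pi) (g \o rho) M = mcost (wt S) (wt S') pi rho M.
Proof.
move=> ef eg; rewrite /mcost (loss_embedding _ _ ef) (loss_embedding _ _ eg).
congr (_ + _); apply: eq_bigr => p _.
by rewrite (segment_embedding _ _ _ ef) (segment_embedding _ _ _ eg).
Qed.

Lemma embedding_root S T (f : S -> T) w s :
  embedding f w -> s != troot S -> f s != troot T.
Proof.
move=> [fle _ _]; apply: contra => /eqP fs; apply/eqP/root_vle.
by rewrite -fle fs vle_root.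
Qed.

Lemma mapping_embedding S T S' T' (f : S -> T) (g : S' -> T') w z
    (I : finType) (pi : I -> S) (rho : I -> S') M :
  embedding f w -> embedding g z ->
  mapping pi rho M -> mapping (f \o pi) (g \o rho) M.
Proof.
move=> ef eg [le_pi inj nr]; have [fle _ _] := ef; have [gle _ _] := eg.
split=> [p q pM qM|p q pM qM /(embedding_inj ef)|p pM] /=.
- by rewrite fle gle le_pi.
- exact: inj.
- have /andP[pr rr] := nr p pM.
  by rewrite (embedding_root ef pr) (embedding_root eg rr).
Qed.

Lemma eq_owns T (I : finType) (pi pi2 : I -> T) (M : {set I}) :
  {in M, pi =1 pi2} -> owns pi M =2 owns pi2 M.
Proof.
move=> e p v; rewrite /owns; case: (boolP (p \in M)) => //= pM; rewrite e //.
congr (_ && _); apply: eq_forallb => q; case: (boolP (q \in M)) => //= qM.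
by rewrite e.
Qed.

Lemma eq_mcost T T' (I : finType) (pi pi2 : I -> T) (rho rho2 : I -> T')
    (M : {set I}) w z :
  {in M, pi =1 pi2} -> {in M, rho =1 rho2} ->
  mcost w z pi rho M = mcost w z pi2 rho2 M.
Proof.
move=> /eq_owns e /eq_owns e'; rewrite /mcost /loss; congr (_ + _ + _).
- by apply: eq_bigl => v; apply: eq_forallb => p; rewrite e.
- by apply: eq_bigl => v; apply: eq_forallb => p; rewrite e'.
- by apply: eq_bigr => p _; congr dX; apply: eq_bigl => v; rewrite ?e ?e'.
Qed.

Lemma mapping_pullback S T S' T' (f : S -> T) (g : S' -> T') w z
    (I : finType) (pi : I -> T) (rho : I -> T') M :
    embedding f w -> embedding g z -> mapping pi rho M ->
    {in M, forall p, exists2 s, s != troot S & f s = pi p} ->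
    {in M, forall p, exists2 s, s != troot S' & g s = rho p} ->
  exists pi1 rho1, mapping pi1 rho1 M /\
    mcost (wt S) (wt S') pi1 rho1 M = mcost w z pi rho M.
Proof.
move=> ef eg [le_pi inj nr] piM rhoM; have [fle _ _] := ef; have [gle _ _] := eg.
pose pull (A B : dendrogram X) (h : A -> B) b := odflt (troot A) [pick a | h a == b].
pose pi1 p := pull S T f (pi p); pose rho1 p := pull S' T' g (rho p).
have pullP (A B : dendrogram X) (h : A -> B) b : injective h ->
    (exists2 a, a != troot A & h a = b) ->
    h (pull A B h b) = b /\ pull A B h b != troot A.
  move=> h_inj [a ar <-]; rewrite /pull; case: pickP => [c /eqP/h_inj ->|/(_ a)] //.
  by rewrite eqxx.
have pi1P p : p \in M -> f (pi1 p) = pi p /\ pi1 p != troot S.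
  by move=> pM; apply: pullP (piM p pM); exact: embedding_inj ef.
have rho1P p : p \in M -> g (rho1 p) = rho p /\ rho1 p != troot S'.
  by move=> pM; apply: pullP (rhoM p pM); exact: embedding_inj eg.
exists pi1, rho1; split; last first.
  by rewrite -(mcost_embedding _ _ _ ef eg); apply: eq_mcost => p /=;
    [case/pi1P | case/rho1P].
split=> [p q pM qM|p q pM qM e|p pM].
- by rewrite -fle -gle !(proj1 (pi1P _ _)) // !(proj1 (rho1P _ _)) // le_pi.
- by apply: inj => //; rewrite -(proj1 (pi1P _ pM)) e (proj1 (pi1P _ qM)).
- by rewrite (proj2 (pi1P _ pM)) (proj2 (rho1P _ pM)).
Qed.

(** * Every edit path is dominated by a mapping *)

Definition mapped T T' (c : R) : Prop :=
  exists (I : finType) (pi : I -> T) (rho : I -> T') (M : {set I}),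
    mapping pi rho M /\ mcost (wt T) (wt T') pi rho M <= c.

Lemma iso_embedding S T : dendro_iso S T ->
  exists2 f : S -> T, bijective f /\ f (troot S) = troot T & embedding f (wt T).
Proof.
move=> [f [fb fr fp fw]]; have f_inj := bij_inj fb; exists f => //; split.
- have fi n a : iter n (parent T) (f a) = f (iter n (parent S) a).
    by elim: n => //= n ->; rewrite fp.
  move=> a b; apply/vleP/vleP => -[n e]; exists n; last by rewrite fi e.
  by apply: f_inj; rewrite -fi.
- by move=> v; have [g _ gK] := fb; rewrite -[v]gK codom_f.
- move=> s; rewrite /wt -fr (inj_eq f_inj); case: ifPn => // sr; exact: fw.
Qed.

Lemma dendro_iso_sym S T : dendro_iso S T -> dendro_iso T S.
Proof.
move=> [f [[g fK gK] fr fp fw]]; exists g; split.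
- by exists f.
- by rewrite -fr fK.
- by move=> v; apply: (can_inj fK); rewrite fp !gK.
- move=> v vr; rewrite -[in RHS](gK v) fw //.
  by apply: contraNneq vr => e; rewrite -(gK v) e fr.
Qed.

Lemma dendro_iso_refl T : dendro_iso T T.
Proof. by exists id; split=> //; exists id. Qed.

Lemma dendro_iso_trans S T U : dendro_iso S T -> dendro_iso T U -> dendro_iso S U.
Proof.
move=> [f [fb fr fp fw]] [g [gb gr gp gw]]; exists (g \o f); split=> /=.
- exact: bij_comp.
- by rewrite fr.
- by move=> v; rewrite fp gp.
- by move=> v vr; rewrite gw ?fw // -fr (inj_eq (bij_inj fb)).
Qed.

Lemma mapped_iso S T T' c : dendro_iso S T -> mapped S T' c -> mapped T T' c.
Proof.
move=> /iso_embedding[f _ ef] [I [pi [rho [M [mM leM]]]]].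
exists I, (f \o pi), (id \o rho), M; split.
  exact: mapping_embedding ef (embedding_id T') mM.
by rewrite (mcost_embedding _ _ _ ef (embedding_id T')).
Qed.

(** All the non-root vertices are matched, and each owns itself. *)
Lemma iso_mapped T T' : dendro_iso T T' -> mapped T T' 0.
Proof.
move=> /iso_embedding[f [fb fr] ef]; have [fle _ wf] := ef.
pose M := [set v : T | v != troot T].
have own v p : v != troot T -> owns id M p v = (p == v).
  move=> vr; apply/idP/eqP => [/ownsP[pM pv]|->]; last by apply: owns_self; rewrite inE.
  move/(_ v); rewrite inE vr => /(_ isT (vle_refl _)) vp; exact: vle_anti.
suff idM : mapping id id M /\ mcost (wt T) (wt T) id id M <= 0.
  have [mM leM] := idM; exists T, id, (f \o id), M; split.
    exact: (mapping_embedding (embedding_id T) ef mM).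
  by rewrite (mcost_embedding _ _ _ (embedding_id T) ef).
split; first by split=> // p; rewrite inE => ->.
rewrite /mcost [X in _ + X]big1 ?addr0 => [|p _]; last exact: dXxx.
rewrite /loss big1 ?addr0 // => v; rewrite /wt; case: eqP => [_ _|/eqP vr].
  exact: dXxx.
by move/forallP/(_ v); rewrite own ?eqxx.
Qed.

Section Contract.
Variables (T : dendrogram X) (v : T) (vr : v != troot T).

(** Deleting and ghosting build trees with the same underlying order, the
    restriction of that of T. *)
Lemma vle_delete (x y : delete vr) : vle x y = vle (val x) (val y).
Proof.
apply/idP/idP => /vleP[n].
  elim: n x => [|n IH] x; first by move=> <-; exact: vle_refl.
  rewrite iterSr => /IH; apply: vle_trans.
  rewrite [X in vle _ X]val_remove_parent; case: eqP => [e|_]; last exact: vle_parent.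
  by apply: vle_trans (vle_parent _) _; rewrite e; exact: vle_parent.
(* one step in the contracted tree may be two steps in T, whence a strong
   induction on the length of the path in T *)
have [k] := ubnP n; elim: k n x => // k IH [|n] x; rewrite ltnS => nk.
  by move=> /= e; rewrite (val_inj e) vle_refl.
rewrite iterSr => e; apply: vle_trans (vle_parent x) _.
have [pv|pv] := eqVneq (parent T (val x)) v; last first.
  by apply: (IH n) => //; rewrite [val _]val_remove_parent (negPf pv).
case: n nk e => [|n] nk; rewrite pv.
  by move=> /= e; case/negP: (valP y); apply/eqP/esym.
rewrite iterSr => e; apply: (IH n); first exact: ltnW.
by rewrite [val _]val_remove_parent pv eqxx.
Qed.

Lemma delete_codom (u : T) : u != v -> exists s : delete vr, val s = u.
Proof. by move=> uv; exists (exist _ u uv). Qed.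

Lemma delete_rootE (s : delete vr) : (s == troot (delete vr)) = (val s == troot T).
Proof. by []. Qed.

Lemma delete_embedding :
  embedding (val : delete vr -> T) (reset (wt T) v).
Proof.
split=> [a b|u|s]; first by rewrite vle_delete.
  rewrite /reset; case: eqVneq => // /delete_codom[s <-]; by rewrite codom_f.
rewrite /reset (negPf (valP s)) /wt delete_rootE; by case: ifP.
Qed.

Lemma ghost_embedding c : children v = [set c] -> v != c ->
  embedding (val : ghost vr -> T) (shift (wt T) v c).
Proof.
move=> cE vc; split=> [a b|u|s].
- exact: (esym (vle_delete a b)).
- rewrite /shift; case: eqVneq => // /delete_codom[s <-].
  by rewrite (codom_f (val : ghost vr -> T)).
have : (val s \in children v) = (val s == c) by rewrite cE inE.
have e : (s == troot (ghost vr)) = (val s == troot T) by [].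
rewrite inE /shift (negPf (valP s)) /wt e (negPf vr) /= /ghost_weight.
have [sr|_] /= := eqVneq (val s) (troot T); last by move=> ->.
by move=> <-.
Qed.

Lemma pullback_contract (S : dendrogram X) T' (f : S -> T) w (I : finType)
    (pi : I -> T) (rho : I -> T') M :
    embedding f w -> f (troot S) = troot T ->
    (forall u, u != v -> exists s, f s = u) ->
    mapping pi rho M -> {in M, forall p, pi p != v} ->
  mapped S T' (mcost w (wt T') pi rho M).
Proof.
move=> ef fr fv mM nv; have [_ _ nr] := mM.
have [|p pM|pi1 [rho1 [m1 e1]]] := mapping_pullback ef (embedding_id T') mM.
- move=> p pM; have [s fs] := fv _ (nv p pM); exists s => //.
  by apply: contraTneq (proj1 (andP (nr p pM))) => e; rewrite -fs e fr eqxx.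
- by exists (rho p) => //; have /andP[] := nr p pM.
by exists I, pi1, rho1, M; rewrite e1.
Qed.

Lemma mapped_delete T' c :
  mapped (delete vr) T' c -> mapped T T' (dX (weight T v) 0 + c).
Proof.
move=> [I [pi [rho [M [mM leM]]]]].
have m2 := mapping_embedding delete_embedding (embedding_id T') mM.
exists I, (val \o pi), (id \o rho), M; split=> //; have [_ inj _] := m2.
apply: le_trans (le_mcost_weight (reset (wt T) v) _ _ _ inj) _.
rewrite addrC; apply: lerD; last first.
  by rewrite (mcost_embedding _ _ _ delete_embedding (embedding_id T')).
by under eq_bigr do rewrite dX_sym; rewrite sum_dX_reset dX_sym /wt (negPf vr).
Qed.

(** Setting the weight of v to 0 accounts for the edit; only then is v freed of
    its partner, at no further cost. *)
Lemma mapped_undelete T' c :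
  mapped T T' c -> mapped (delete vr) T' (dX (weight T v) 0 + c).
Proof.
move=> [I [pi [rho [M [mM leM]]]]]; have [_ inj _] := mM.
have [||pi2 [M2 [m2 nv le2]]] := avoid_null (w := reset (wt T) v) (wt T') mM vr.
- by rewrite /reset eqxx.
- by rewrite /reset /wt eqxx; case: ifP.
have := pullback_contract delete_embedding (erefl _) (@delete_codom) m2 nv.
move=> [J [pi3 [rho3 [M3 [m3 le3]]]]]; exists J, pi3, rho3, M3; split=> //.
apply: le_trans le3 (le_trans le2 _).
apply: le_trans (le_mcost_weight (wt T) _ _ _ inj) _.
by rewrite sum_dX_reset dX_sym addrC /wt (negPf vr) lerD2l.
Qed.

Hypothesis d2 : degree2 v.

Lemma mapped_ghost T' c : mapped (ghost vr) T' c -> mapped T T' c.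
Proof.
move=> [I [pi [rho [M [mM leM]]]]]; have [d [_ dE vd _ le_d]] := degree2P d2.
have ef := ghost_embedding dE vd.
have m2 := mapping_embedding ef (embedding_id T') mM.
exists I, (val \o pi), (id \o rho), M; split=> //.
rewrite -(mcost_shift _ _ _ vd).
  by rewrite (mcost_embedding _ _ _ ef (embedding_id T')).
by apply: owns_ext => q _; rewrite le_d /= (valP (pi q)) andbT.
Qed.

(** Here v has to lose its partner before its weight is moved to its child,
    because the two may have different owners until then. *)
Lemma mapped_unghost T' c : mapped T T' c -> mapped (ghost vr) T' c.
Proof.
move=> [I [pi [rho [M [mM leM]]]]]; have [d [_ dE vd _ le_d]] := degree2P d2.
have [pi2 [M2 [m2 nv le2]]] := avoid_degree2 (wt T) (wt T') mM d2.
have := pullback_contract (ghost_embedding dE vd) (erefl _) (@delete_codom) m2 nv.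
move=> [J [pi3 [rho3 [M3 [m3 le3]]]]]; exists J, pi3, rho3, M3; split=> //.
apply: le_trans le3 _; rewrite mcost_shift //; first exact: le_trans le2 _.
by apply: owns_ext => q qM; rewrite le_d nv ?andbT.
Qed.

End Contract.

Lemma mapped_shrink T T' (v : T) y (y0 : y != 0) c : v != troot T ->
  mapped (shrink v y0) T' c -> mapped T T' (dX (weight T v) y + c).
Proof.
move=> vr [I [pi [rho [M [mM leM]]]]].
have mM' : mapping (T := T) pi rho M := mM.
exists I, pi, rho, M; split=> //; have [_ inj _] := mM'.
apply: le_trans (le_mcost_weight (wt (shrink v y0)) _ _ _ inj) _.
rewrite addrC; apply: lerD => //.
rewrite (bigD1 v) //= big1 => [|u uv]; rewrite /wt /= /shrink_weight.
  by rewrite (negPf vr) eqxx addr0.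
by rewrite (negPf uv) dXxx.
Qed.

Lemma mapped_edit_path T T' c : edit_path T T' c -> mapped T T' c.
Proof.
elim=> {T T' c} [T T'|T T1 T' c c' e _ IH]; first exact: iso_mapped.
case: e IH => [v y vr y0|v vr|v vr|v vr d2|v vr d2] iso IH.
- exact: (mapped_shrink vr (mapped_iso (dendro_iso_sym iso) IH)).
- exact: (mapped_delete (mapped_iso (dendro_iso_sym iso) IH)).
- exact: mapped_iso iso (mapped_undelete _ IH).
- by rewrite add0r; exact: (mapped_ghost d2 (mapped_iso (dendro_iso_sym iso) IH)).
- by rewrite add0r; exact: mapped_iso iso (mapped_unghost _ d2 IH).
Qed.

End Embeddings.

Arguments wt {R X} T v.

(** * Every mapping is realized by an edit path *)

Section Realization.
Variables (R : realType) (X : editableType R).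
Implicit Types S T U : dendrogram X.

(** The two edits that remove a vertex; the remaining ones, apart from
    shrinkings, are their inverses. *)
Variant reduce T U : R -> Prop :=
| ReduceDelete (v : T) (vr : v != troot T) (_ : dendro_iso (delete vr) U) :
    reduce T U (dX (weight T v) 0)
| ReduceGhost (v : T) (vr : v != troot T) (_ : degree2 v)
    (_ : dendro_iso (ghost vr) U) : reduce T U 0.

Lemma reduce_edit T U c : reduce T U c -> edit T U c.
Proof. by case=> [v vr|v vr d2] iso; [exact: EditDelete iso|exact: EditGhost iso]. Qed.

Lemma reduce_edit_rev T U c : reduce U T c -> edit T U c.
Proof. by case=> [v vr|v vr d2] iso; [exact: EditInsert iso|exact: EditSplit iso]. Qed.

Lemma reduce_iso S T U c : reduce T S c -> dendro_iso S U -> reduce T U c.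
Proof.
case=> [v vr|v vr d2] iso iso2; have iso3 := dendro_iso_trans iso iso2.
  exact: ReduceDelete iso3.
exact: ReduceGhost d2 iso3.
Qed.

(** A reduction of the target is undone at the end of the path. *)
Lemma edit_path_expand T T' U c c' :
  edit_path T U c -> reduce T' U c' -> edit_path T T' (c + c').
Proof.
move=> tu; elim: tu T' => {T U c} [T U iso|T T1 U c c1 e _ IH] T' red.
  rewrite add0r -[c']addr0; apply: (PathStep (T1 := T')).
    exact: reduce_edit_rev (reduce_iso red (dendro_iso_sym iso)).
  exact: PathIso (dendro_iso_refl T').
by rewrite -addrA; apply: PathStep e _; exact: IH.
Qed.

Lemma mcost_sym T T' (I : finType) (pi : I -> T) (rho : I -> T') w z (M : {set I}) :
  mcost w z pi rho M = mcost z w rho pi M.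
Proof.
by rewrite /mcost [loss w _ _ + _]addrC; under eq_bigr do rewrite dX_sym.
Qed.

Lemma mapping_sym T T' (I : finType) (pi : I -> T) (rho : I -> T') (M : {set I}) :
  mapping pi rho M -> mapping rho pi M.
Proof.
move=> mM; have [le_pi _ nr] := mM; split=> [p q pM qM||p pM].
- by rewrite le_pi.
- exact: mapping_inj_r mM.
- by rewrite andbC nr.
Qed.

Lemma mapped_sym T T' (c : R) : mapped T T' c -> mapped T' T c.
Proof.
move=> [I [pi [rho [M [mM leM]]]]]; exists I, rho, pi, M.
by rewrite mcost_sym; split=> //; exact: mapping_sym.
Qed.

Lemma card_delete T (v : T) (vr : v != troot T) : (#|delete vr| < #|T|)%N.
Proof.
have -> : #|delete vr| = #|[pred u | u != v]| by exact: card_sig.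
by rewrite cardC1 prednK //; apply/card_gt0P; exists v.
Qed.

(** Two children of v would both lie above the owner of v, hence be comparable. *)
Lemma degree2_owned T (I : finType) (pi : I -> T) (M : {set I}) p v :
    v != troot T -> owns pi M p v -> pi p != v ->
    (forall u, u != troot T -> ~~ unowned pi M u) ->
  degree2 v.
Proof.
move=> vr /ownsP[_ pv hv] npv owned; rewrite /degree2 vr.
have [c cv pc] := vle_children pv npv; apply/cards1P; exists c.
apply/setP => d; rewrite finset.in_set1; apply/idP/eqP => [dv|->] //.
move: cv dv; rewrite !inE => /andP[cr /eqP cv] /andP[dr /eqP dv].
have /unownedPn[q /ownsP[qM qd _]] := owned d dr.
have qc : vle (pi q) c.
  apply: vle_trans pc; apply: hv => //; apply: vle_trans qd _.
  by rewrite -dv vle_parent.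
have no (a b : T) : a != troot T -> parent T a = v -> b != troot T ->
    parent T b = v -> a != b -> ~~ vle a b.
  move=> ar av br bv ab; apply/negP => /(parent_vle ab); rewrite av => vb.
  case/eqP: (parent_neq br); rewrite bv; apply: vle_anti => //.
  by rewrite -bv vle_parent.
apply/eqP; apply: contraT => dc; have := vle_total qd qc.
by rewrite (negPf (no d c dr dv cr cv dc)) (negPf (no c d cr cv dr dv _)) // eq_sym.
Qed.

(** An unmatched vertex can be deleted if some vertex is unowned; otherwise it
    has degree 2 and can be ghosted. *)
Lemma reduce_unmatched T T' (I : finType) (pi : I -> T) (rho : I -> T')
    (M : {set I}) v :
    mapping pi rho M -> v != troot T -> {in M, forall p, pi p != v} ->
  exists U c c', [/\ reduce T U c, mapped U T' c',
    c + c' <= mcost (wt T) (wt T') pi rho M & (#|U| < #|T|)%N].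
Proof.
move=> mM vr nv.
have [/existsP[u /andP[ur uu]]|none] :=
    boolP [exists u, (u != troot T) && unowned pi M u].
  have nu : {in M, forall p, pi p != u}.
    move=> p pM; apply: contraTneq uu => <-; apply/unownedPn; exists p.
    exact: owns_self.
  exists (delete ur), (dX (weight T u) 0).
  exists (mcost (reset (wt T) u) (wt T') pi rho M); split.
  - exact: ReduceDelete (dendro_iso_refl _).
  - exact: (pullback_contract (delete_embedding ur) (erefl _)
      (@delete_codom _ _ _ _ ur) mM nu).
  - by rewrite -[leRHS](mcost_unowned _ _ _ uu) /wt (negPf ur).
  - exact: card_delete.
have owned u : u != troot T -> ~~ unowned pi M u.
  by move=> ur; apply: contra none => uu; apply/existsP; exists u; rewrite ur.
have /unownedPn[p pv] := owned v vr.
have d2 := degree2_owned vr pv (nv _ (owns_mem pv)) owned.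
have [c [_ cE vc _ le_c]] := degree2P d2.
exists (ghost vr), 0, (mcost (shift (wt T) v c) (wt T') pi rho M); split.
- exact: ReduceGhost d2 (dendro_iso_refl _).
- exact: (pullback_contract (ghost_embedding vr cE vc) (erefl _)
    (@delete_codom _ _ _ _ vr) mM nv).
- rewrite add0r mcost_shift //.
  by apply: owns_ext => q qM; rewrite le_c nv ?andbT.
- exact: card_delete.
Qed.

Section Complete.
Variables (T' : dendrogram X) (I : finType) (rho : I -> T') (M : {set I}).
Hypothesis rho_full : forall v, v != troot T' -> exists2 p, p \in M & rho p = v.

Lemma iso_complete T (pi : I -> T) :
    mapping pi rho M -> (forall v, v != troot T -> exists2 p, p \in M & pi p = v) ->
    {in M, forall p, weight T (pi p) = weight T' (rho p)} ->
  dendro_iso T T'.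
Proof.
move=> mM pi_full wM; have [le_pi inj nr] := mM; have inj' := mapping_inj_r mM.
pose partner v u := v = troot T /\ u = troot T' \/
  exists p, [/\ p \in M, pi p = v & rho p = u].
have [f fP] : exists f : T -> T', forall v, partner v (f v).
  apply: (@fin_all_exists T (fun=> T') partner) => v.
  have [->|/pi_full[p pM <-]] := eqVneq v (troot T).
    by exists (troot T'); left.
  by exists (rho p); right; exists p.
have [g gP] : exists g : T' -> T, forall u, partner (g u) u.
  apply: (@fin_all_exists T' (fun=> T) (fun u v => partner v u)) => u.
  have [->|/rho_full[p pM <-]] := eqVneq u (troot T').
    by exists (troot T); left.
  by exists (pi p); right; exists p.
have fpi p : p \in M -> f (pi p) = rho p.
  move=> pM; have /andP[pr _] := nr p pM.
  case: (fP (pi p)) => [[e _]|[q [qM /inj -> //]]]; first by rewrite e eqxx in pr.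
have fr : f (troot T) = troot T'.
  case: (fP (troot T)) => [[] //|[q [qM e]]]; have := nr q qM.
  by rewrite e eqxx.
have gK : cancel g f.
  move=> u; case: (gP u) => [[-> ->]|[p [pM <- <-]]] //; exact: fpi.
have fK : cancel f g.
  move=> v; case: (gP (f v)) => [[-> e]|[p [pM <- e]]].
    case: (fP v) => [[-> //]|[q [qM _ eq]]]; have := nr q qM.
    by rewrite eq e eqxx andbF.
  case: (fP v) => [[_ e']|[q [qM qv e']]]; last by rewrite -qv (inj' p q) // e e'.
  by have := nr p pM; rewrite e e' eqxx andbF.
have fle u v : vle (f u) (f v) = vle u v.
  have rle (U : dendrogram X) (x : U) : vle (troot U) x = (x == troot U).
    by apply/idP/eqP => [/root_vle|->] //; exact: vle_refl.
  have [->|/pi_full[p pM <-]] := eqVneq v (troot T); first by rewrite fr !vle_root.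
  have [->|/pi_full[q qM <-]] := eqVneq u (troot T).
    by rewrite fr !rle fpi //; case/andP: (nr p pM) => /negPf -> /negPf ->.
  by rewrite !fpi // le_pi.
exists f; split=> // [|v|v /pi_full[p pM <-]]; last by rewrite fpi // wM.
  by exists g.
(* the parent is the least vertex strictly above, so that it is preserved by f
   and its inverse g *)
have [->|vr] := eqVneq v (troot T); first by rewrite fr !parent_root.
apply: vle_anti; last first.
  by apply: parent_vle; rewrite ?fle ?vle_parent // (can_eq fK) eq_sym parent_neq.
rewrite -[parent T' _]gK fle; apply: parent_vle; last by rewrite -fle gK vle_parent.
apply: contraTneq (parent_neq (_ : f v != troot T')).
  by move=> e; rewrite {2}e gK eqxx.
by rewrite -fr (can_eq fK).
Qed.

Lemma edit_path_complete T (pi : I -> T) :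
    mapping pi rho M -> (forall v, v != troot T -> exists2 p, p \in M & pi p = v) ->
  edit_path T T' (\sum_(p in M) dX (weight T (pi p)) (weight T' (rho p))).
Proof.
move=> mM pi_full.
(* one shrinking for each pair of different weights *)
have [n] := ubnP #|[set p in M | weight T (pi p) != weight T' (rho p)]|.
elim: n T pi mM pi_full => // n IH T pi mM pi_full ltn; have [_ inj nr] := mM.
have [/exists_inP[p pM wp]|eqw] :=
    boolP [exists p in M, weight T (pi p) != weight T' (rho p)]; last first.
  have wM : {in M, forall p, weight T (pi p) = weight T' (rho p)}.
    move=> p pM; apply/eqP; apply: contraR eqw => h; apply/exists_inP; by exists p.
  rewrite big1 => [|p pM]; last by rewrite wM ?dXxx.
  exact/PathIso/(iso_complete mM).
have /andP[pr rr] := nr p pM; have y0 := weight_neq0 rr.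
have neq q : q \in M -> q != p -> (pi q == pi p) = false.
  by move=> qM; apply: contraNF => /eqP/inj ->.
have := IH (shrink (pi p) y0) pi mM pi_full.
rewrite (big_setD1 p) //= [X in _ -> edit_path _ _ X](big_setD1 p) //=.
rewrite /= /shrink_weight eqxx dXxx add0r => path.
apply: PathStep (EditShrink pr (dendro_iso_refl _)) _.
rewrite (eq_bigr (fun q => dX (weight T (pi q)) (weight T' (rho q)))) in path;
  last by move=> q /setD1P[qp qM]; rewrite neq.
apply: path; rewrite -ltnS; apply: leq_trans ltn; rewrite ltnS; apply: proper_card.
apply/properP; split.
  apply/fintype.subsetP => q; rewrite !inE => /andP[qM]; rewrite qM /= /shrink_weight.
  by have [->|qp] := eqVneq q p; rewrite ?eqxx // neq.
by exists p; rewrite !inE pM //= /shrink_weight !eqxx.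
Qed.

End Complete.

Lemma segment_complete T (I : finType) (pi : I -> T) (M : {set I}) p :
    {in M &, injective pi} ->
    (forall v, v != troot T -> exists2 q, q \in M & pi q = v) ->
    p \in M -> pi p != troot T ->
  segment (wt T) pi M p = weight T (pi p).
Proof.
move=> inj full pM pr; rewrite /segment (bigD1 (pi p)) ?owns_self //= big1.
  by rewrite addr0 /wt (negPf pr).
move=> v /andP[pv vp]; rewrite /wt; case: ifPn => // /full[q qM qv].
by rewrite -qv (owns_uniq inj pv (_ : owns pi M q v)) ?eqxx // -?qv ?owns_self in vp.
Qed.

Lemma loss_ge0 T (I : finType) (pi : I -> T) (M : {set I}) w :
  0 <= loss w pi M :> R.
Proof. by apply: sumr_ge0 => v _; exact: dX_ge0. Qed.

Lemma edit_path_mapped T T' c :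
  mapped T T' c -> exists2 c', edit_path T T' c' & c' <= c.
Proof.
have [n] := ubnP (#|T| + #|T'|); elim: n T T' c => // n IH T T' c; rewrite ltnS => le_n.
move=> [I [pi [rho [M [mM leM]]]]].
have [/existsP[v /andP[vr /forall_inP nv]]|full] :=
    boolP [exists v, (v != troot T) && [forall p in M, pi p != v]].
  have [U [c1 [c2 [red mU le_c lt_U]]]] := reduce_unmatched mM vr nv.
  have [|c' path le_c'] := IH U T' c2 _ mU.
    by apply: leq_trans le_n; rewrite ltn_add2r.
  exists (c1 + c'); first exact: PathStep (reduce_edit red) path.
  by apply: le_trans leM; apply: le_trans le_c; rewrite lerD2l.
have [/existsP[v /andP[vr /forall_inP nv]]|full'] :=
    boolP [exists v, (v != troot T') && [forall p in M, rho p != v]].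
  have [U [c1 [c2 [red mU le_c lt_U]]]] := reduce_unmatched (mapping_sym mM) vr nv.
  have [|c' path le_c'] := IH T U c2 _ (mapped_sym mU).
    by apply: leq_trans le_n; rewrite ltn_add2l.
  exists (c' + c1); first exact: edit_path_expand path red.
  rewrite mcost_sym in leM; apply: le_trans leM; apply: le_trans le_c.
  by rewrite addrC lerD2l.
have fullP (U : dendrogram X) (f : I -> U) :
    ~~ [exists v, (v != troot U) && [forall p in M, f p != v]] ->
    forall v, v != troot U -> exists2 p, p \in M & f p = v.
  move=> h v vr; apply: contrapT => no; case/existsP: h; exists v; rewrite vr.
  by apply/forall_inP => p pM; apply/negP => /eqP e; case: no; exists p.
have pf := fullP _ _ full; have rf := fullP _ _ full'.
exists (\sum_(p in M) dX (weight T (pi p)) (weight T' (rho p))).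
  exact: edit_path_complete.
apply: le_trans leM; have [_ inj nr] := mM.
rewrite /mcost -[leLHS]add0r; apply: lerD; first by rewrite addr_ge0 ?loss_ge0.
apply: ler_sum => p pM; have /andP[pr rr] := nr p pM.
by rewrite !segment_complete //; exact: mapping_inj_r mM.
Qed.

End Realization.

(** * The edit distance as a minimum over mappings *)

Section EditDistMin.
Variables (R : realType) (X : editableType R).
Implicit Types S T U : dendrogram X.

Lemma owns_imset T (I J : finType) (f : I -> J) (pi : J -> T) (M : {set I}) p v :
  p \in M -> owns pi (f @: M) (f p) v = owns (pi \o f) M p v.
Proof.
move=> pM; apply/ownsP/ownsP => [[_ pv hp]|[_ pv hp]]; split=> //.
- by move=> q qM; apply: hp; exact: imset_f.
- exact: imset_f.
- by move=> _ /imsetP[q qM ->]; exact: hp.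
Qed.

Lemma unowned_imset T (I J : finType) (f : I -> J) (pi : J -> T) (M : {set I}) v :
  unowned pi (f @: M) v = unowned (pi \o f) M v.
Proof.
apply: negb_inj; apply/unownedPn/unownedPn => -[p own].
  have /imsetP[q qM e] := owns_mem own; rewrite e owns_imset // in own; by exists q.
by exists (f p); rewrite owns_imset // (owns_mem own).
Qed.

Lemma mcost_imset T T' (I J : finType) (f : I -> J) (pi : J -> T) (rho : J -> T')
    (M : {set I}) w z : mapping (pi \o f) (rho \o f) M ->
  mapping pi rho (f @: M) /\
  mcost w z pi rho (f @: M) = mcost w z (pi \o f) (rho \o f) M.
Proof.
move=> [le_pi inj nr].
have f_inj : {in M &, injective f} by move=> p q pM qM e; apply: inj; rewrite //= e.
split.
  split=> [_ _ /imsetP[p pM ->] /imsetP[q qM ->]|_ _ /imsetP[p pM ->] /imsetP[q qM ->] e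
          |_ /imsetP[p pM ->]].
  - exact: le_pi.
  - by rewrite (inj p q).
  - exact: nr.
rewrite /mcost /loss; under eq_bigl do rewrite unowned_imset.
congr (_ + _ + _); first by under eq_bigl do rewrite unowned_imset.
rewrite big_imset //=; apply: eq_bigr => p pM.
by congr dX; apply: eq_bigl => v; exact: owns_imset.
Qed.

Lemma edit_path_ge0 T T' (c : R) : edit_path T T' c -> 0 <= c.
Proof.
elim=> // {T T' c} T T1 T' c c' e _ c'0; apply: addr_ge0 => //.
by case: e => *; rewrite ?dX_ge0.
Qed.

Lemma edit_dist_le T T' c : mapped T T' c -> edit_dist T T' <= c.
Proof.
case/edit_path_mapped => c' path; apply: le_trans; apply: ge_inf => //.
by exists 0 => x /edit_path_ge0.
Qed.

(** Every mapping costs as much as a set of pairs, and there are finitely many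
    of those, so that the infimum is attained. *)
Theorem edit_dist_min T T' : exists2 M : {set T * T'}, mapping fst snd M &
  edit_dist T T' = mcost (wt T) (wt T') fst snd M.
Proof.
pose c (M : {set T * T'}) := mcost (wt T) (wt T') fst snd M.
have m0 : mapping fst snd (finset.set0 : {set T * T'}).
  by split=> [p q|p q|p]; rewrite inE.
pose P (M : {set T * T'}) := `[< mapping fst snd M >].
have P0 : P finset.set0 by exact/asboolP.
have [M /asboolP mM minM] := arg_minP (P := P) c P0.
exists M => //; apply/le_anti; rewrite edit_dist_le; last by exists _, fst, snd, M.
apply: lb_le_inf.
  have [|e path _] := @edit_path_mapped R X T T' (c finset.set0); last by exists e.
  by exists _, fst, snd, finset.set0.
move=> e /mapped_edit_path[I [pi [rho [N [mN le_e]]]]].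
have [m2 e2] :=
  @mcost_imset T T' I _ (fun p => (pi p, rho p)) fst snd N (wt T) (wt T') mN.
by apply: le_trans le_e; rewrite -e2; apply: minM; apply/asboolP.
Qed.

End EditDistMin.

(** * Least common ancestors *)

Section Ancestors.
Variables (R : realType) (X : editableType R) (T : dendrogram X).
Implicit Types u v x y : T.

Lemma card_vlt u v : vlt u v ->
  (#|[set x | vle x u]| < #|[set x | vle x v]|)%N.
Proof.
case/andP => uv le_uv; apply: proper_card; apply/properP; split.
  by apply/fintype.subsetP => x; rewrite !inE => /vle_trans; exact.
exists v; rewrite !inE ?vle_refl //; apply: contra uv => vu.
exact/eqP/vle_anti.
Qed.

Lemma vlt_vleF u v : vlt v u -> vle u v = false.
Proof. by case/andP => /eqP vu le_vu; apply/negP => /(vle_anti le_vu). Qed.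

(** The vertices above a given one form a chain, so a nonempty set of them has
    a least element. *)
Lemma vminP (P : pred T) x v : P v -> (forall u, P u -> vle x u) ->
  P (vmin P) /\ forall u, P u -> vle (vmin P) u.
Proof.
move=> Pv xP; rewrite /vmin; case: pickP => [m /andP[Pm /forallP mP]|no] /=.
  by split=> // u; apply/implyP.
have [m Pm mP] := arg_minnP (fun u => #|[set x | vle x u]|) Pv.
have := no m; rewrite Pm => /= /negP[]; apply/forallP => u; apply/implyP => Pu.
have /orP[//|um] := vle_total (xP _ Pm) (xP _ Pu).
have [->|ne] := eqVneq u m; first exact: vle_refl.
by have := card_vlt (_ : vlt u m); rewrite /vlt ne um ltnNge mP // => /(_ isT).
Qed.

Lemma LCA_le x y v : vle (LCA x y) v = vle x v && vle y v.
Proof.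
have [] := @vminP (fun v => vle x v && vle y v) x (troot T).
- by rewrite !vle_root.
- by move=> u /andP[].
rewrite -/(LCA x y) => /andP[xl yl] least; apply/idP/idP => [lv|]; last exact: least.
by rewrite (vle_trans xl) // (vle_trans yl).
Qed.

(** Unless v is the root, Omega lies below v if and only if an element of A other
    than x does. *)
Lemma vlt_Omega (A : {set T}) x v : x \in A -> vle x v ->
  vlt v (Omega A x) = (v != troot T) && [forall y in A, vle y v ==> (y == x)].
Proof.
move=> xA xv; have [->|vr] /= := eqVneq v (troot T).
  by apply/negP => /andP[/eqP rO /root_vle] e; rewrite e in rO.
rewrite /Omega; case: ifPn => [A2|]; last first.
  rewrite -leqNgt => /card_le1_eqP A1; rewrite /vlt vr vle_root; apply/esym/forall_inP.
  by move=> y yA; apply/implyP => _; apply/eqP; exact: A1.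
set L := imset _ _; have [y yA yx] : exists2 y, y \in A & y != x.
  have /card_gt0P[y] : (0 < #|A :\ x|)%N by rewrite (cardsD1 x) xA in A2.
  by case/setD1P; exists y.
have lca_mem u : u \in L -> exists2 y, (y \in A) && (y != x) & u = LCA x y.
  by case/imsetP => u' /setD1P[ux uA] ->; exists u'; rewrite ?uA.
have [] := @vminP (mem L) x (LCA x y).
- by apply: imset_f; rewrite in_setD1 yx.
- move=> u /lca_mem[u' _ ->]; have := LCA_le x u' (LCA x u').
  by rewrite vle_refl => /esym/andP[].
rewrite -[vmin (mem L)]/(vmin (fun v => v \in L)) => /lca_mem[m /andP[mA mx] eO] least.
have Ov : vle (vmin (fun v => v \in L)) v = [exists y in A, vle y v && (y != x)].
  apply/idP/exists_inP => [|[u uA /andP[uv ux]]].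
    by rewrite eO LCA_le => /andP[_ mv]; exists m; rewrite ?mv.
  apply: vle_trans (least (LCA x u) _) _; last by rewrite LCA_le xv uv.
  by apply: imset_f; rewrite in_setD1 ux.
have -> : [forall y in A, vle y v ==> (y == x)] =
    ~~ [exists y in A, vle y v && (y != x)].
  rewrite negb_exists_in; apply: eq_forallb => u.
  by rewrite negb_and negbK -implybE.
rewrite -Ov; have xO : vle x (vmin (fun v => v \in L)).
  by rewrite eO; have := LCA_le x m (LCA x m); rewrite vle_refl => /esym/andP[].
apply/idP/idP => [/andP[vO le_vO]|nO].
  by apply: contra vO => /(vle_anti le_vO) ->.
have := vle_total xO xv; rewrite (negPf nO) /= /vlt => ->.
by rewrite andbT; apply: contraNneq nO => <-; exact: vle_refl.
Qed.

End Ancestors.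

Lemma sum_disjoint (V : nmodType) (J K : finType) (P : pred J) (Q : J -> pred K)
    (F : K -> V) :
    (forall p p' q, P p -> P p' -> Q p q -> Q p' q -> p = p') ->
  \sum_(p | P p) \sum_(q | Q p q) F q = \sum_(q | [exists p, P p && Q p q]) F q.
Proof.
move=> uniq; rewrite (exchange_big_dep (fun q => [exists p, P p && Q p q])) /=.
  apply: eq_bigr => q /existsP[p /andP[Pp Qp]]; rewrite (big_pred1 p) // => p'.
  by apply/andP/eqP => [[Pp' Qp']|->] //; exact: uniq Pp' Pp Qp' Qp.
by move=> p q Pp Qp; apply/existsP; exists p; rewrite Pp.
Qed.

(** * Splitting a mapping along its maximal pairs *)

Section Tops.
Variables (R : realType) (X : editableType R) (T : dendrogram X) (I : finType).
Variables (pi : I -> T) (M : {set I}).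
Hypothesis pi_inj : {in M &, injective pi}.
Implicit Types (p q : I) (u v : T) (w : T -> X).

(** Like below, this only refers to the order of the marked vertices, so that the
    two trees of a mapping define the same sets of indices. *)
Definition tops : {set I} :=
  [set p in M | [forall q in M, vle (pi p) (pi q) ==> vle (pi q) (pi p)]].

Definition below p : {set I} :=
  [set q in M | vle (pi q) (pi p) && ~~ vle (pi p) (pi q)].

Definition restrict w x : T -> X := fun v => if vlt v x then w v else 0.

Lemma topsP p : reflect (p \in M /\ forall q, q \in M -> vle (pi p) (pi q) -> q = p)
  (p \in tops).
Proof.
rewrite inE; apply: (iffP andP) => -[pM h]; split=> //.
  move=> q qM pq; apply: pi_inj => //; apply: vle_anti => //.
  by move/forall_inP: h => /(_ q qM)/implyP; exact.
by apply/forall_inP => q qM; apply/implyP => /(h _ qM) ->; exact: vle_refl.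
Qed.

Lemma tops_mem p : p \in tops -> p \in M.
Proof. by case/topsP. Qed.

Lemma belowE p q : (q \in below p) = (q \in M) && vlt (pi q) (pi p).
Proof.
rewrite inE; congr (_ && _); apply/andP/andP => [[qp pq]|[nqp qp]]; split=> //.
  by apply: contra pq => /eqP ->; exact: vle_refl.
by apply: contra nqp => pq; exact/eqP/vle_anti.
Qed.

Lemma le_tops q : q \in M -> exists2 p, p \in tops & vle (pi q) (pi p).
Proof.
move=> qM; pose P p := (p \in M) && vle (pi q) (pi p).
have Pq : P q by rewrite /P qM vle_refl.
have [p /andP[pM qp] pP] := arg_maxnP (fun p => #|[set x | vle x (pi p)]|) Pq.
exists p => //; apply/topsP; split=> // s sM ps.
apply/eqP; apply: contraT => sp.
have le_s : (#|[set x | vle x (pi s)]| <= #|[set x | vle x (pi p)]|)%N.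
  by apply: pP; rewrite /P sM (vle_trans qp).
have := card_vlt (_ : vlt (pi p) (pi s)); rewrite ltnNge le_s /vlt ps andbT; apply.
by apply: contra sp => /eqP e; apply/eqP/pi_inj.
Qed.

Lemma tops_disjoint p p' v : p \in tops -> p' \in tops ->
  vle v (pi p) -> vle v (pi p') -> p = p'.
Proof.
move=> /topsP[pM hp] /topsP[pM' hp'] vp vp'.
by case/orP: (vle_total vp vp') => [/(hp _ pM')|/(hp' _ pM)].
Qed.

Lemma tops_incomparable : incomparable (pi @: tops).
Proof.
move=> _ _ /imsetP[p pt ->] /imsetP[q qt ->] pq; apply/andP.
split; apply: contra pq => h; apply/eqP; congr pi.
  exact: tops_disjoint pt qt (vle_refl _) h.
exact: tops_disjoint pt qt h (vle_refl _).
Qed.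

(** A marked vertex below v lies below a maximal one; the latter is below v
    too, unless it is above v and hence above pi p, which is maximal. *)
Lemma owns_topE p v : p \in tops ->
  owns pi M p v = vle (pi p) v && [forall y in pi @: tops, vle y v ==> (y == pi p)].
Proof.
move=> pt; have /topsP[pM hp] := pt; apply/ownsP/andP => [[_ pv h]|[pv /forall_inP h]].
  split=> //; apply/forall_inP => _ /imsetP[q qt ->]; apply/implyP.
  by have /topsP[_ hq] := qt; move=> /(h _ (tops_mem qt)) /(hq _ pM) ->.
split=> // q qM qv; have [p' pt' qp'] := le_tops qM.
have := vle_total qv qp' => /orP[vp'|pv'].
  by rewrite (tops_disjoint pt pt' (vle_refl _) (vle_trans pv vp')).
have /eqP e := implyP (h (pi p') (imset_f _ pt')) pv'.
by rewrite -e.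
Qed.

Lemma owns_top q v : (forall p', p' \in tops -> ~~ vlt v (pi p')) ->
  owns pi M q v -> q \in tops.
Proof.
move=> nv /ownsP[qM qv h]; have [p pt qp] := le_tops qM.
have pv : vle (pi p) v.
  have /orP[vp|//] := vle_total qv qp.
  by move: (nv p pt); rewrite /vlt vp andbT negbK => /eqP ->; exact: vle_refl.
by have /topsP[pM hp] := pt; rewrite (hp q qM (h p pM pv)).
Qed.

(** Every marked vertex below v is counted in below p. *)
Lemma owns_belowE p q v : vlt v (pi p) ->
  owns pi (below p) q v = owns pi M q v.
Proof.
move=> /andP[vp le_vp]; have mem r : vle (pi r) v -> (r \in below p) = (r \in M).
  move=> rv; rewrite belowE /vlt (vle_trans rv) // andbT andb_idr // => _.
  by apply: contra vp => /eqP e; apply/eqP/vle_anti => //; rewrite -e.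
apply/ownsP/ownsP => -[qM qv h]; rewrite mem // in qM *; split=> // r rM rv;
  by apply: h => //; rewrite mem in rM *.
Qed.

(** A non-maximal marked vertex owns nothing outside the subtree of the maximal
    one above it. *)
Lemma owns_below p q v : p \in tops -> q \in below p ->
  owns pi M q v = owns pi (below p) q v && vlt v (pi p).
Proof.
move=> pt qp; apply/idP/andP => [own|[own vp]]; last by rewrite -(owns_belowE _ vp).
suff vp : vlt v (pi p) by rewrite owns_belowE.
have /ownsP[qM qv h] := own; move: qp; rewrite belowE => /andP[_ /andP[nqp le_qp]].
apply: contraT => nvp; have pv : vle (pi p) v.
  have /orP[vp|//] := vle_total qv le_qp.
  by move: nvp; rewrite /vlt vp andbT negbK => /eqP ->; exact: vle_refl.
by case/eqP: nqp; apply: vle_anti => //; exact: h (tops_mem pt) pv.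
Qed.

Lemma loss_split w : loss w pi M =
  \sum_(v | unowned pi M v && ~~ [exists p in tops, vlt v (pi p)]) dX (w v) 0 +
  \sum_(p in tops) loss (restrict w (pi p)) pi (below p).
Proof.
have -> : \sum_(p in tops) loss (restrict w (pi p)) pi (below p) =
    \sum_(p in tops) \sum_(v | unowned pi M v && vlt v (pi p)) dX (w v) 0 :> R.
  apply: eq_bigr => p _; rewrite /loss [LHS]big_mkcond [RHS]big_mkcond /=.
  apply: eq_bigr => v _; rewrite /restrict; case: (boolP (vlt v (pi p))) => vp.
    rewrite andbT; congr (if _ then _ else _); apply: eq_forallb => q.
    by rewrite owns_belowE.
  by rewrite andbF dXxx; case: ifP.
rewrite sum_disjoint; last first.
  move=> p p' v pt pt' /andP[_ /andP[_ vp]] /andP[_ /andP[_ vp']].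
  exact: tops_disjoint vp vp'.
rewrite /loss (bigID (fun v => [exists p in tops, vlt v (pi p)])) /= addrC.
congr (_ + _); apply: eq_bigl => v; apply/andP/existsP.
  by move=> [uv /exists_inP[p pt vp]]; exists p; rewrite pt uv.
by move=> [p /and3P[pt uv vp]]; split=> //; apply/exists_inP; exists p.
Qed.

Lemma sum_split (F : I -> R) : \sum_(q in M) F q =
  \sum_(p in tops) F p + \sum_(p in tops) \sum_(q in below p) F q.
Proof.
rewrite sum_disjoint; last first.
  move=> p p' q pt pt'; rewrite !belowE => /andP[_ /andP[_ qp]] /andP[_ /andP[_ qp']].
  exact: tops_disjoint qp qp'.
rewrite (bigID (mem tops)) /=; congr (_ + _); apply: eq_bigl => q.
  by rewrite andb_idl // => /tops_mem.
apply/andP/existsP => [[qM nq]|[p /andP[pt]]].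
  have [p pt qp] := le_tops qM; exists p; rewrite pt belowE qM /vlt qp andbT.
  by apply: contra nq => /eqP /(pi_inj qM (tops_mem pt)) ->.
rewrite belowE => /andP[qM /andP[nqp qp]]; split=> //; apply: contra nqp => qt.
by rewrite (tops_disjoint qt pt (vle_refl _) qp).
Qed.

Let A : {set T} := pi @: tops.

Lemma owns_Omega p v : p \in tops ->
  vle (pi p) v && vlt v (Omega A (pi p)) = (v != troot T) && owns pi M p v.
Proof.
move=> pt; rewrite owns_topE //; case: (boolP (vle (pi p) v)) => [pv|_] /=.
  by rewrite vlt_Omega // imset_f.
by rewrite andbF.
Qed.

Lemma path_weight_segment p : p \in tops ->
  path_weight A (pi p) = segment (wt T) pi M p.
Proof.
move=> pt; rewrite /path_weight (eq_bigl _ _ (fun v => owns_Omega v pt)).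
rewrite big_mkcondl; apply: eq_bigr => v _; rewrite /wt.
by case: (v == troot T).
Qed.

Lemma deletedE v : v != troot T -> ~~ [exists p in tops, vlt v (pi p)] ->
  deleted A v = unowned pi M v.
Proof.
move=> vr nv; have nA : ~~ [exists x in A, vlt v x].
  apply: contra nv => /exists_inP[_ /imsetP[p pt ->] vp].
  by apply/exists_inP; exists p.
have own_Omega p : p \in tops -> vle (pi p) v ->
    vlt v (Omega A (pi p)) = owns pi M p v.
  by move=> pt pv; have := owns_Omega v pt; rewrite pv vr.
rewrite /deleted /ghosted vr nA andbT /=; apply/andP/idP => [[vA ng]|uv].
  apply: contraT => /unownedPn[p own]; have /ownsP[_ pv _] := own.
  have pt : p \in tops.
    apply: owns_top own => p' pt'; apply: contra nv => h.
    by apply/exists_inP; exists p'.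
  case/exists_inP: ng; exists (pi p); first exact: imset_f.
  rewrite own_Omega // own /vlt pv !andbT; apply: contra vA => /eqP <-.
  exact: imset_f.
split.
  apply: contraTN uv => /imsetP[p pt ->]; apply/unownedPn; exists p.
  exact: owns_self (tops_mem pt).
apply: contraTN uv => /exists_inP[_ /imsetP[p pt ->] /andP[/andP[_ pv]]].
by rewrite own_Omega // => own; apply/unownedPn; exists p.
Qed.

Lemma loss_deleted :
  \sum_(v | unowned pi M v && ~~ [exists p in tops, vlt v (pi p)])
     dX (wt T v) 0 =
  \sum_(v | deleted A v) dX (weight T v) 0 :> R.
Proof.
rewrite (bigID (fun v => v == troot T)) /= big1 ?add0r => [|v /andP[_ /eqP ->]].
  have nA v : deleted A v -> ~~ [exists p in tops, vlt v (pi p)].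
    case/and4P => _ _ _; apply: contra => /exists_inP[p pt vp].
    by apply/exists_inP; exists (pi p) => //; exact: imset_f.
  apply: eq_big => [v|v /andP[_ vr]]; last by rewrite /wt (negPf vr).
  apply/andP/idP => [[/andP[uv nv] vr]|dv]; first by rewrite deletedE.
  have vr : v != troot T by case/andP: dv.
  by rewrite -deletedE ?nA ?dv.
by rewrite /wt eqxx dXxx.
Qed.

End Tops.

Section Split.
Variables (R : realType) (X : editableType R) (T T' : dendrogram X).
Implicit Types (M : {set T * T'}).

Section Maps.
Variables (I : finType) (pi : I -> T) (rho : I -> T') (M : {set I}).
Hypothesis mM : mapping pi rho M.

Lemma tops_sym : tops rho M = tops pi M.
Proof.
have [le_pi _ _] := mM; apply/setP => p; rewrite !inE; apply: andb_id2l => pM.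
by apply: eq_forallb_in => q qM; rewrite !le_pi.
Qed.

Lemma below_sym p : p \in M -> below rho M p = below pi M p.
Proof.
have [le_pi _ _] := mM; move=> pM; apply/setP => q; rewrite !inE.
by apply: andb_id2l => qM; rewrite !le_pi.
Qed.

Lemma mcost_split w z : mcost w z pi rho M =
  \sum_(v | unowned pi M v && ~~ [exists p in tops pi M, vlt v (pi p)]) dX (w v) 0 +
  \sum_(v | unowned rho M v && ~~ [exists p in tops pi M, vlt v (rho p)]) dX (z v) 0 +
  \sum_(p in tops pi M) dX (segment w pi M p) (segment z rho M p) +
  \sum_(p in tops pi M)
    mcost (restrict w (pi p)) (restrict z (rho p)) pi rho (below pi M p).
Proof.
have [_ inj _] := mM; have inj' := mapping_inj_r mM.
rewrite /mcost !big_split /= (loss_split inj w) (loss_split inj' z) tops_sym.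
rewrite (sum_split inj).
have -> : \sum_(p in tops pi M) loss (restrict z (rho p)) rho (below rho M p) =
    \sum_(p in tops pi M) loss (restrict z (rho p)) rho (below pi M p).
  by apply: eq_bigr => p /(tops_mem inj) pM; rewrite below_sym.
have -> : \sum_(p in tops pi M) \sum_(q in below pi M p)
      dX (segment w pi M q) (segment z rho M q) =
    \sum_(p in tops pi M) \sum_(q in below pi M p)
      dX (segment (restrict w (pi p)) pi (below pi M p) q)
         (segment (restrict z (rho p)) rho (below pi M p) q).
  apply: eq_bigr => p pt; have pM := tops_mem inj pt; apply: eq_bigr => q qp.
  congr dX; rewrite /segment /restrict -big_mkcondr; apply: eq_bigl => v.
    exact: owns_below.
  by rewrite -below_sym //; apply: (owns_below inj'); rewrite ?tops_sym ?below_sym.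
lra.
Qed.

End Maps.

Lemma mcost_alpha M : mapping fst snd M ->
  mcost (wt T) (wt T') fst snd M = alpha_cost (tops fst M) +
  \sum_(p in tops fst M) mcost (restrict (wt T) p.1)
     (restrict (wt T') p.2) fst snd (below fst M p).
Proof.
move=> mM; have [_ inj nr] := mM; have inj' := mapping_inj_r mM.
rewrite (mcost_split mM) (loss_deleted inj) -(tops_sym mM) (loss_deleted inj').
rewrite /alpha_cost /= (tops_sym mM); congr (_ + _ + _).
apply: eq_bigr => p pt; congr dX; first by rewrite -(path_weight_segment inj).
by rewrite -(path_weight_segment inj') (tops_sym mM).
Qed.

Lemma matching_tops M : mapping fst snd M -> matching (tops fst M).
Proof.
move=> mM; have [_ inj nr] := mM; have inj' := mapping_inj_r mM.
have topsM := tops_mem inj; split.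
- by move=> p /topsM/nr.
- split; first exact: tops_incomparable.
  by rewrite /projr -(tops_sym mM); exact: tops_incomparable.
- by split=> p q /topsM pM /topsM qM; [exact: inj | exact: inj'].
Qed.

End Split.

(** * Mappings between subtrees *)

Section Subtrees.
Variables (R : realType) (X : editableType R).

Section Sub.
Variables (T : dendrogram X) (x : T).
Implicit Types s : sub_dendrogram x.

Lemma vle_sub (a b : sub_dendrogram x) : vle a b = vle (val a) (val b).
Proof.
apply/idP/idP => /vleP[n].
  elim: n a => [|n IH] a; first by move=> <-; exact: vle_refl.
  rewrite iterSr => /IH; apply: vle_trans.
  have [->|ar] := eqVneq a (troot (sub_dendrogram x)).
    by rewrite [parent _ _]sub_parent_root; exact: vle_refl.
  by rewrite [X in vle _ X]val_sub_parent //; exact: vle_parent.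
elim: n a => [|n IH] a; first by move=> /= /val_inj ->; exact: vle_refl.
rewrite iterSr => e; have [ar|ar] := eqVneq a (troot (sub_dendrogram x)).
  suff -> : b = a by exact: vle_refl.
  apply/val_inj/vle_anti; first by rewrite ar; exact: (valP b).
  by apply/vleP; exists n.+1; rewrite iterSr.
apply: vle_trans (vle_parent a) _; apply: IH.
by rewrite [val _]val_sub_parent.
Qed.

Lemma sub_embedding :
  embedding (val : sub_dendrogram x -> T) (restrict (wt T) x).
Proof.
split=> [a b|u|s]; first by rewrite vle_sub.
  rewrite /restrict; case: ifP => // /andP[_ ux].
  by rewrite (codom_f (val : sub_dendrogram x -> T) (exist _ u ux)).
rewrite /restrict /wt; have -> : (s == troot (sub_dendrogram x)) = (val s == x) by [].
rewrite /vlt (valP s : is_true (vle (val s) x)) andbT.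
case: eqVneq => //= sx; case: eqVneq => // /(@sub_val_root _ _ _ x s) e.
by rewrite e eqxx in sx.
Qed.

End Sub.

Variables (T T' : dendrogram X).
Implicit Types (M : {set T * T'}).

Lemma edit_dist_sub_le M x y : mapping fst snd M ->
    {in M, forall q, vlt q.1 x && vlt q.2 y} ->
  edit_dist (sub_dendrogram x) (sub_dendrogram y) <=
  mcost (restrict (wt T) x) (restrict (wt T') y) fst snd M.
Proof.
move=> mM Mxy; apply: edit_dist_le.
have pull (U : dendrogram X) (u v : U) : vlt u v ->
    exists2 s, s != troot (sub_dendrogram v) & val s = u.
  by case/andP => uv le_uv; exists (exist _ u le_uv).
have [||pi [rho [m e]]] := mapping_pullback (sub_embedding x) (sub_embedding y) mM.
- by move=> q /Mxy/andP[qx _]; exact: pull.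
- by move=> q /Mxy/andP[_ qy]; exact: pull.
by exists _, pi, rho, M; rewrite e.
Qed.

Lemma edit_dist_sub_mapping x y : exists M, [/\ mapping fst snd M,
    {in M, forall q, vlt q.1 x && vlt q.2 y} &
    edit_dist (sub_dendrogram x) (sub_dendrogram y) =
    mcost (restrict (wt T) x) (restrict (wt T') y) fst snd M].
Proof.
have [N mN ->] := edit_dist_min (sub_dendrogram x) (sub_dendrogram y).
have ex := sub_embedding x; have ey := sub_embedding y.
pose f (q : sub_dendrogram x * sub_dendrogram y) : T * T' := (val q.1, val q.2).
have m2 := mapping_embedding ex ey mN.
have [m3 e3] := @mcost_imset _ _ _ _ _ _ f fst snd N (restrict (wt T) x)
  (restrict (wt T') y) m2.
exists (f @: N); split=> //; last by rewrite e3 -(mcost_embedding _ _ _ ex ey).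
have [_ _ nr] := mN; move=> _ /imsetP[q qN ->] /=; have /andP[q1 q2] := nr q qN.
by rewrite /vlt; apply/andP; split; apply/andP; split=> //;
  [exact: (valP q.1) | exact: (valP q.2)].
Qed.

(** A matching, completed below each of its pairs by an optimal mapping of the
    subtrees, is a mapping whose maximal pairs are those of the matching. *)
Lemma matching_extends M : matching M -> exists N, [/\ mapping fst snd N,
    tops fst N = M &
    {in M, forall p, edit_dist (sub_dendrogram p.1) (sub_dendrogram p.2) =
      mcost (restrict (wt T) p.1) (restrict (wt T') p.2) fst snd (below fst N p)}].
Proof.
move=> [nr [inc1 inc2] [inj1 inj2]].
have [B BP] := fin_all_exists (fun p : T * T' => edit_dist_sub_mapping p.1 p.2).
have le1 p q : p \in M -> q \in M -> vle p.1 q.1 -> p = q.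
  move=> pM qM pq; apply: inj1 => //; apply/eqP; apply: contraTT pq => h.
  by have /andP[] := inc1 _ _ (imset_f _ pM) (imset_f _ qM) h.
have le2 p q : p \in M -> q \in M -> vle p.2 q.2 -> p = q.
  move=> pM qM pq; apply: inj2 => //; apply/eqP; apply: contraTT pq => h.
  by have /andP[] := inc2 _ _ (imset_f _ pM) (imset_f _ qM) h.
(* B p is an optimal mapping between the subtrees of the pair p *)
pose N := [set q | [exists p in M, (q == p) || (q \in B p)]].
have NP q : reflect (exists2 p, p \in M & q = p \/ q \in B p) (q \in N).
  rewrite inE; apply: (iffP exists_inP) => -[p pM h]; exists p => //.
    by case/orP: h => [/eqP|]; [left|right].
  by case: h => [->|->]; rewrite ?eqxx ?orbT.
have Ble p q : q = p \/ q \in B p -> vle q.1 p.1 && vle q.2 p.2.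
  case=> [->|]; first by rewrite !vle_refl.
  by have [_ h _] := BP p; move=> /h /andP[/andP[_ ->] /andP[_ ->]].
have cross p p' q q' : p \in M -> p' \in M -> p != p' ->
    q = p \/ q \in B p -> q' = p' \/ q' \in B p' ->
    vle q.1 q'.1 = false /\ vle q.2 q'.2 = false.
  move=> pM pM' pp' /Ble/andP[q1 q2] /Ble/andP[q1' q2'].
  split; apply: contraNF pp' => h; apply/eqP.
    by case/orP: (vle_total q1 (vle_trans h q1')) => [/le1|/le1 e]; [exact|rewrite e].
  by case/orP: (vle_total q2 (vle_trans h q2')) => [/le2|/le2 e]; [exact|rewrite e].
have Blt p q : q \in B p -> vlt q.1 p.1 && vlt q.2 p.2.
  by have [_ h _] := BP p; exact: h.
have mN : mapping fst snd N.
  have leN : {in N &, forall p q, vle p.1 q.1 = vle p.2 q.2}.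
    move=> q q' /NP[p pM qp] /NP[p' pM' qp'].
    have [e|pp'] := eqVneq p p'; last first.
      by have [-> ->] := cross _ _ _ _ pM pM' pp' qp qp'.
    rewrite -e in qp'; have [[leB _ _] _ _] := BP p.
    case: qp qp' => [->|qB] [->|qB'].
    - by rewrite !vle_refl.
    - have /andP[h1 h2] := Blt _ _ qB'.
      by rewrite !vlt_vleF.
    - by have /andP[-> ->] := Ble p q (or_intror qB).
    - exact: leB.
  split=> // [p q pN qN e|q /NP[p pM [->|qB]]].
  - apply/eqP; rewrite -pair_eqE /= e eqxx /=; apply/eqP/vle_anti.
      by rewrite -leN // e vle_refl.
    by rewrite -leN // e vle_refl.
  - exact: nr.
  - by have [[_ _ nrB] _ _] := BP p; exact: nrB.
have [_ injN _] := mN.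
have MN p : p \in M -> p \in N by move=> pM; apply/NP; exists p => //; left.
have topsN : tops fst N = M.
  apply/setP => q; apply/(topsP injN)/idP => [[/NP[p pM [-> //|qB]] h]|qM].
    have /andP[/andP[_ qp] _] := Blt _ _ qB.
    by rewrite -(h p (MN p pM) qp).
  split=> [|r /NP[p' pM' h] qq']; first exact: MN.
  case: (eqVneq q p') => [e|qp'].
    by case: h => [-> //|/Blt/andP[]]; rewrite -e => /vlt_vleF; rewrite qq'.
  by have [] := cross _ _ _ _ qM pM' qp' (or_introl erefl) h; rewrite qq'.
exists N; split=> // p pM; have [_ _ ->] := BP p; congr mcost.
apply/setP => q; rewrite belowE //; apply/idP/andP => [qB|[/NP[p' pM' h] qp]].
  by split; [apply/NP; exists p => //; right | have /andP[] := Blt _ _ qB].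
have [e|pp'] := eqVneq p' p.
  by rewrite e in h; case: h => // e'; rewrite e' /vlt eqxx in qp.
have [] := cross _ _ _ _ pM' pM pp' h (or_introl erefl).
by case/andP: qp => _ ->.
Qed.

End Subtrees.

(** * The decomposition formula *)

Theorem theorem3 (R : realType) (X : editableType R) (T T' : dendrogram X)
    (hT : no_degree2 T) (hT' : no_degree2 T') :
  let F (M : {set T * T'}) : R :=
    \sum_(p in M) edit_dist (sub_dendrogram p.1) (sub_dendrogram p.2) + alpha_cost M in
  (exists2 M, matching M & edit_dist T T' = F M) /\
  (forall M, matching M -> edit_dist T T' <= F M).
Proof.
move=> F.
have leF M : matching M -> edit_dist T T' <= F M.
  case/matching_extends => N [mN <- distN]; apply: edit_dist_le.
  exists _, fst, snd, N; split=> //.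
  by rewrite (mcost_alpha mN) /F addrC lerD2r; apply: ler_sum => p pN; rewrite distN.
split=> //; have [M mM distM] := edit_dist_min T T'.
have mt := matching_tops mM; exists (tops fst M) => //.
apply/le_anti; rewrite leF //= distM (mcost_alpha mM) /F addrC lerD2l.
apply: ler_sum => p pt; have [_ inj _] := mM; have pM := tops_mem inj pt.
apply: edit_dist_sub_le.
  by apply: mapping_sub mM; apply/fintype.subsetP => q; rewrite inE => /andP[].
move=> q qp; move: (qp); rewrite belowE // => /andP[_ ->].
have inj' := mapping_inj_r mM.
by move: qp; rewrite -(below_sym mM) // belowE // => /andP[].
Qed.
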